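(* Let $\kappa\in\mathbb{R}$ and let $(X,d_X)$ be a $\mathrm{Cycl}_4(\kappa)$ space. Then for any integer $n\geq 3$ and any map $f:\mathbb{Z}/n\mathbb{Z}\to X$ satisfying $$\sum_{i\in\mathbb{Z}/n\mathbb{Z}}d_X\left(f(i),f(i+[1]_n)\right)<2D_\kappa \quad\text{and}\quad f(j)\neq f(j+[1]_n)\ \text{ for every } j\in\mathbb{Z}/n\mathbb{Z},$$ there exists a map $g:\mathbb{Z}/n\mathbb{Z}\to M_\kappa^2$ satisfying the following two conditions: (1) For any $i,j\in\mathbb{Z}/n\mathbb{Z}$, $$d_\kappa(g(i),g(i+[1]_n))=d_X(f(i),f(i+[1]_n)),\qquad d_\kappa(g(i),g(j))\geq d_X(f(i),f(j)).$$ (2) For any $i,j\in\mathbb{Z}/n\mathbb{Z}$ with $i\neq j$, $[g(i),g(j)]\cap[g(i-[1]_n),g(i+[1]_n)]\neq\emptyset$.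
   Context: For $\kappa\in\mathbb{R}$, $M_\kappa^2$ is the complete, simply-connected, two-dimensional Riemannian manifold of constant Gaussian curvature $\kappa$, with distance function $d_\kappa$, and $D_\kappa$ is its diameter: $D_\kappa=\pi/\sqrt{\kappa}$ if $\kappa>0$, $D_\kappa=\infty$ if $\kappa\leq 0$. For $a,b\in M_\kappa^2$ with $d_\kappa(a,b)<D_\kappa$, $[a,b]$ denotes the unique geodesic (line) segment with endpoints $a,b$ (so $[a,a]=\{a\}$). For integers $n\ge 1$ and $m$, $[m]_n$ denotes the class of $m$ in $\mathbb{Z}/n\mathbb{Z}$. Definition. For an integer $n\geq 4$, a metric space $(X,d_X)$ is a $\mathrm{Cycl}_n(\kappa)$ space if for any map $f:\mathbb{Z}/n\mathbb{Z}\to X$ with $\sum_{i\in\mathbb{Z}/n\mathbb{Z}}d_X(f(i),f(i+[1]_n))<2D_\kappa$ there exists a map $g:\mathbb{Z}/n\mathbb{Z}\to M_\kappa^2$ such that $d_\kappa(g(i),g(i+[1]_n))\leq d_X(f(i),f(i+[1]_n))$ for every $i$, and $d_\kappa(g(i),g(j))\geq d_X(f(i),f(j))$ for any $i,j$ with $j\neq i+[1]_n$ and $i\neq j+[1]_n$. *)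

(* Defs.v *)
From HB Require Import structures.
From mathcomp Require Import all_boot all_order all_algebra.
From mathcomp Require Import all_classical all_reals all_analysis.

Set Implicit Arguments.
Unset Strict Implicit.
Unset Printing Implicit Defensive.

Import Order.TTheory GRing.Theory Num.Theory.

Local Open Scope classical_set_scope.
Local Open Scope ring_scope.

(* The inverse of cosh : [0, +oo[ -> [1, +oo[. *)
Definition arcosh (R : realType) (x : R) : R := ln (x + Num.sqrt (x ^+ 2 - 1)).

(* The two-dimensional model space of constant curvature k has the points of
   the unit sphere in R^3 if 0 < k, of the plane R^2 = R^2 x {0} if k = 0, and
   of the upper sheet of the hyperboloid z^2 - x^2 - y^2 = 1 if k < 0. The
   factor 1 / sqrt `|k| that yields curvature k is put on the distance. *)
Definition model_point (R : realType) (k : R) (p : R * R * R) : bool :=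
  let: (x, y, z) := p in
  if 0 < k then x ^+ 2 + y ^+ 2 + z ^+ 2 == 1
  else if k < 0 then (z ^+ 2 - x ^+ 2 - y ^+ 2 == 1) && (0 < z)
  else z == 0.

Definition model (R : realType) (k : R) : Type :=
  {p : R * R * R | model_point k p}.

Definition model_dist (R : realType) (k : R) (p q : model k) : R :=
  let: (x, y, z) := \val p in
  let: (x', y', z') := \val q in
  if 0 < k then acos (x * x' + y * y' + z * z') / Num.sqrt k
  else if k < 0 then arcosh (z * z' - x * x' - y * y') / Num.sqrt (- k)
  else Num.sqrt ((x - x') ^+ 2 + (y - y') ^+ 2).

Definition model_diam (R : realType) (k : R) : \bar R :=
  if 0 < k then (pi / Num.sqrt k)%:E else +oo%E.

(* The values of c outside [0, d(a, b)] are irrelevant. When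
   d(a, b) < model_diam k, any two such c agree on [0, d(a, b)] and
   [model_segment a b] is their common image of that interval; otherwise it is
   the union of all geodesics from a to b. *)
Definition is_geodesic (R : realType) (k : R) (a b : model k)
    (c : R -> model k) : Prop :=
  [/\ c 0 = a, c (model_dist a b) = b &
    forall s t, 0 <= s <= model_dist a b -> 0 <= t <= model_dist a b ->
      model_dist (c s) (c t) = `|s - t|].

Definition model_segment (R : realType) (k : R) (a b : model k) :
    set (model k) :=
  [set p | exists c : R -> model k, is_geodesic a b c /\
     exists2 t : R, 0 <= t <= model_dist a b & c t = p].

Definition perimeter (R : realType) (X : metricType R) (n : nat)
    (f : 'Z_n -> X) : R :=
  \sum_(i : 'Z_n) mdist (f i) (f (i + 1)).

(* Only meant for 4 <= n (and 'Z_n is Z/nZ only for 2 <= n). *)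
Definition Cycl (R : realType) (n : nat) (k : R) (X : metricType R) : Prop :=
  forall f : 'Z_n -> X,
    ((perimeter f)%:E < 2%:E * model_diam k)%E ->
    exists g : 'Z_n -> model k,
      (forall i, model_dist (g i) (g (i + 1)) <= mdist (f i) (f (i + 1))) /\
      (forall i j, j <> i + 1 -> i <> j + 1 ->
         mdist (f i) (f j) <= model_dist (g i) (g j)).

(* Main.v *)
Require Import Defs.
From HB Require Import structures.
From mathcomp Require Import all_boot all_order all_algebra.
From mathcomp Require Import all_classical all_reals all_analysis.
From mathcomp Require Import ring lra zify.

Set Implicit Arguments.
Unset Strict Implicit.
Unset Printing Implicit Defensive.

Import Order.TTheory GRing.Theory Num.Theory.

Local Open Scope classical_set_scope.
Local Open Scope ring_scope.

(* The proof is by induction on the number of vertices, for abstract data: an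
   n-point metric in which only the cyclically ordered quadruples are compared
   with the model plane.  A triangle b = f(n-1), a = f(0), c = f(n-2) is glued
   along [a, c] to a convex comparison polygon for f(0), ..., f(n-2).  If every
   segment from b to another vertex crosses [a, c], the glued polygon is convex
   and the four-point condition gives the inequality for the new diagonals.
   Otherwise the glued polygon has a reflex angle, say at a.  Replace then the
   distance from f(n-1) to each vertex y by the largest distance to y of a point
   lying within the prescribed distances of a and of c.  Each maximum is
   attained, which makes the four-point condition for the new metric immediate,
   and the reflex angle makes f(n-1), f(0), f(1) collinear for it.  The induction
   hypothesis for f(1), ..., f(n-1) then gives a convex polygon, in which f(0) is
   inserted on the side from f(n-1) to f(1).

   The three geometries are treated together: the surface
   z^2 + eps (x^2 + y^2) = 1, with eps = 1, 0, -1, is respectively the sphere, a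
   plane and the hyperboloid, and segments are traces of positive cones, so that
   crossings of segments are linear identities between vectors of R^3. *)

(** * Trigonometry of the three geometries *)

(** Everything rests on one comparison, [crossing]: if [a, c] and [b, y] meet, then lengthening
    [a, c] while shortening the four sides of the quadrilateral cannot lengthen [b, y]. It serves
    three times: for convex gluing, for the extremality of an apex, and for the final insertion of
    f(0). The data are abstract because the maximising point depends on y, so the new distances come
    from no single configuration. In a quadruple i < j < k < n-1 only the distance from n-1 to the
    opposite vertex j has to be attained; towards i and k upper bounds suffice, and every admissible
    point respects them. Hence the maximiser for j alone proves the condition. The perimeter is
    kept: at a reflex angle the hinge f(n-1), f(0), f(1) can be straightened, so the maximum at f(1)
    is exactly the sum of the two sides at f(0). On the sphere the bound 2 pi on the perimeter
    ensures that a straightened hinge is still minimising. *)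

Variant geom := Sph | Euc | Hyp.

Definition eps (R : realType) (g : geom) : R :=
  match g with Sph => 1 | Euc => 0 | Hyp => -1 end.

HB.lock Definition cs (R : realType) (g : geom) (t : R) : R :=
  match g with
  | Sph => cos t | Euc => 1 | Hyp => (expR t + expR (- t)) / 2
  end.

HB.lock Definition sn (R : realType) (g : geom) (t : R) : R :=
  match g with
  | Sph => sin t | Euc => t | Hyp => (expR t - expR (- t)) / 2
  end.

Section Trigonometry.
Variables (R : realType) (g : geom).
Implicit Types s t m : R.
Local Notation eps := (eps R g).
Local Notation cs := (@cs R g).
Local Notation sn := (@sn R g).

(* Half the squared chord of the model surface, as a function of the distance:
   [1 - cos t], [t ^+ 2 / 2], or [cosh t - 1]. *)
Definition hsq t : R := (sn t ^+ 2 + eps * (1 - cs t) ^+ 2) / 2.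

(** The possible distances, an interval on which [hsq] is increasing. *)
Definition rng t : Prop := 0 <= t /\ (g = Sph -> t <= pi).

(** Excludes antipodal pairs, for which the segment is not unique. *)
Definition small t : Prop := g = Sph -> t < pi.

Definition arcd m : R :=
  match g with
  | Sph => acos (1 - m) | Euc => Num.sqrt (2 * m) | Hyp => arcosh (1 + m)
  end.

Lemma csE t : cs t =
  match g with
  | Sph => cos t | Euc => 1 | Hyp => (expR t + expR (- t)) / 2
  end.
Proof. by rewrite cs.unlock. Qed.

Lemma snE t : sn t =
  match g with
  | Sph => sin t | Euc => t | Hyp => (expR t - expR (- t)) / 2
  end.
Proof. by rewrite sn.unlock. Qed.

Lemma expR_mulN t : expR t * expR (- t) = 1.
Proof. by rewrite -expRD subrr expR0. Qed.

Lemma cs0 : cs 0 = 1.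
Proof. by rewrite csE; case: g; rewrite ?cos0 // oppr0 expR0; lra. Qed.

Lemma sn0 : sn 0 = 0.
Proof. by rewrite snE; case: g; rewrite ?sin0 // oppr0 expR0; lra. Qed.

Lemma csN t : cs (- t) = cs t.
Proof. by rewrite !csE; case: g; rewrite ?cosN // opprK addrC. Qed.

Lemma snN t : sn (- t) = - sn t.
Proof. by rewrite !snE; case: g; rewrite ?sinN // opprK; lra. Qed.

Lemma csD s t : cs (s + t) = cs s * cs t - eps * (sn s * sn t).
Proof.
rewrite !csE !snE /eps; case: g; rewrite ?cosD ?opprD ?expRD; first by ring.
  by ring.
by field.
Qed.

Lemma snD s t : sn (s + t) = sn s * cs t + cs s * sn t.
Proof.
rewrite !csE !snE /eps; case: g; rewrite ?sinD ?opprD ?expRD; first by ring.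
  by ring.
by field.
Qed.

Lemma cs2 t : cs t ^+ 2 = 1 - eps * sn t ^+ 2.
Proof.
have := csD t (- t); rewrite subrr cs0 csN snN => ->; ring.
Qed.

Lemma hsqE t : hsq t = (sn t ^+ 2 + eps * (1 - cs t) ^+ 2) / 2.
Proof. by []. Qed.

(** In the flat case both sides vanish. This is why distances are measured by [hsq], which stays
    injective there, and not by [cs]. *)
Lemma hsq_curv t : eps * hsq t = 1 - cs t.
Proof.
by have := cs2 t; rewrite /hsq /eps !csE !snE; case: g => H; lra.
Qed.

Lemma hsq0 : hsq 0 = 0.
Proof. by rewrite /hsq cs0 sn0; ring. Qed.

Lemma hsqN t : hsq (- t) = hsq t.
Proof. by rewrite /hsq csN snN sqrrN. Qed.

(** The right-hand side is [md] of two points at distances s and t from the pole in opposite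
    directions, the form needed for the law of cosines. *)
Lemma hsqD s t : hsq (s + t) =
  (sn s ^+ 2 + sn t ^+ 2 + eps * (cs s - cs t) ^+ 2) / 2 + sn s * sn t.
Proof.
have := (cs2 s, cs2 t); rewrite /hsq csD snD /eps.
have : eps = 0 -> cs s = 1 /\ cs t = 1 by rewrite /eps !csE; case: g; lra.
set a := cs s; set b := cs t; set c := sn s; set d := sn t.
by rewrite /eps; case: g => H [Ha Hb]; [|have [-> ->] := H erefl|];
  field: Ha Hb.
Qed.

Lemma hsqB s t : hsq (s - t) =
  (sn s ^+ 2 + sn t ^+ 2 + eps * (cs s - cs t) ^+ 2) / 2 - sn s * sn t.
Proof. by rewrite hsqD csN snN sqrrN mulrN. Qed.

Lemma sn_gt0 t : 0 < t -> small t -> 0 < sn t.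
Proof.
rewrite /small snE; case: g => // t0 tp.
  by apply: sin_gt0_pi; rewrite t0 tp.
have : expR (- t) < expR t by rewrite ltr_expR; lra.
lra.
Qed.

Lemma sn_ge0 t : rng t -> 0 <= sn t.
Proof.
rewrite /rng snE; case: g => -[t0 tp] //.
  by apply: sin_ge0_pi; rewrite t0 tp.
have : expR (- t) <= expR t by rewrite ler_expR; lra.
lra.
Qed.

Lemma lt_hsq s t : rng s -> rng t -> s < t -> hsq s < hsq t.
Proof.
move=> [s0 sp] [t0 tp] st.
have := (hsq_curv s, hsq_curv t); rewrite /hsq /eps !csE !snE.
move: sp tp; case: g => sp tp [Hs Ht].
- have : cos t < cos s by rewrite ltr_cos ?in_itv /= ?s0 ?t0 ?sp ?tp.
  by lra.
- by nra.
have es : 1 <= expR s by rewrite -expR0 ler_expR.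
have et : expR s < expR t by rewrite ltr_expR.
have [Ms Mt] := (expR_mulN s, expR_mulN t).
suff : expR s + expR (- s) < expR t + expR (- t) by lra.
move: es et Ms Mt; rewrite !expRN.
set a := expR s; set b := expR t => a1 ab _ _.
rewrite -subr_gt0.
have -> : b + b^-1 - (a + a^-1) = (b - a) * (a * b - 1) / (a * b).
  by field; apply/andP; split; lra.
have b1 : 1 < b by lra.
have ab1 : 1 < a * b by apply: (lt_le_trans b1); rewrite ler_peMl //; lra.
by apply: divr_gt0; [apply: mulr_gt0|]; lra.
Qed.

Lemma hsq_le s t : rng s -> rng t -> (hsq s <= hsq t) = (s <= t).
Proof.
move=> Hs Ht; apply/idP/idP => [|st].
  by rewrite leNgt => H; rewrite leNgt; apply: contra H => /lt_hsq; apply.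
by move: st; rewrite le_eqVlt => /predU1P[->//|/lt_hsq H]; apply/ltW/H.
Qed.

Lemma hsq_inj s t : rng s -> rng t -> hsq s = hsq t -> s = t.
Proof.
by move=> Hs Ht H; apply/eqP;
  rewrite eq_le -(hsq_le Hs Ht) -(hsq_le Ht Hs) H lexx.
Qed.

Lemma hsq_ge0 t : rng t -> 0 <= hsq t.
Proof.
move=> Ht; rewrite -hsq0 hsq_le //; first by case: Ht.
by split=> // _; exact: pi_ge0.
Qed.

Lemma hsq_2piB t : g = Sph -> hsq (pi *+ 2 - t) = hsq t.
Proof.
move=> gS; rewrite hsqB /hsq !csE !snE gS sin2pi cos2pi; ring.
Qed.

Lemma cs_gt0 t : g <> Sph -> 0 < cs t.
Proof.
rewrite csE; case: g => // _; have := expR_gt0 t; have := expR_gt0 (- t); lra.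
Qed.

Lemma cs_pi : g = Sph -> cs pi = -1.
Proof. by rewrite csE => ->; exact: cospi. Qed.

Lemma cs_gtN1 t : rng t -> small t -> -1 < cs t.
Proof.
have [] : g = Sph \/ g <> Sph by case: g; [left|right|right].
  rewrite /rng /small csE => -> [t0 _] tp /=; rewrite -cospi ltr_cos ?tp //.
    by rewrite in_itv /= t0 ltW // tp.
  by rewrite in_itv /= pi_ge0 lexx.
by move=> gS _ _; have := cs_gt0 t gS; lra.
Qed.

Lemma arcd_rng m : 0 <= m -> (g = Sph -> m <= 2) -> rng (arcd m).
Proof.
rewrite /rng /arcd; case: g => m0 m2.
- have m2' := m2 erefl.
  by split=> [|_]; [apply: acos_ge0|apply: acos_lepi]; apply/andP; split; lra.
- by split=> //; exact: sqrtr_ge0.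
split=> //; rewrite /arcosh ln_ge0 //.
have := sqrtr_ge0 ((1 + m) ^+ 2 - 1); lra.
Qed.

Lemma arcdK m : 0 <= m -> (g = Sph -> m <= 2) -> hsq (arcd m) = m.
Proof.
move=> m0 m2; have := hsq_curv (arcd m); move: m2.
rewrite /hsq /arcd /eps !csE !snE; case: g => m2.
- have m2' := m2 erefl.
  rewrite acosK; last by rewrite in_itv /=; apply/andP; split; lra.
  by lra.
- by move=> _; rewrite sqr_sqrtr; [lra|nra].
rewrite /arcosh expRN lnK; last first.
  by rewrite posrE; have := sqrtr_ge0 ((1 + m) ^+ 2 - 1); lra.
have H : 0 <= (1 + m) ^+ 2 - 1 by nra.
have := sqr_sqrtr H; have := sqrtr_ge0 ((1 + m) ^+ 2 - 1).
set r := Num.sqrt _ => r0 rE.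
have -> : (1 + m + r)^-1 = 1 + m - r.
  apply: (@mulfI _ (1 + m + r)); first by apply: lt0r_neq0; lra.
  by rewrite divff; [lra|apply: lt0r_neq0; lra].
by lra.
Qed.

Lemma arcdE t : rng t -> arcd (hsq t) = t.
Proof.
move=> Ht; have H0 := hsq_ge0 Ht.
have H2 : g = Sph -> hsq t <= 2.
  move=> gS; have := hsq_curv t; rewrite csE /eps gS mul1r => ->.
  by have := cos_geN1 t; lra.
by apply: hsq_inj => //; [apply: arcd_rng|rewrite arcdK].
Qed.

End Trigonometry.
Arguments eps {R}.

(** * The model surface *)

(* For [Euc] the plane is lifted to height [z = 1], so that in all three cases
   geodesic segments are the central projections of positive cones. *)
Definition on_surface (R : realType) (g : geom) (u : R * R * R) : bool :=
  let: (x, y, z) := u in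
  (z ^+ 2 == 1 - eps g * (x ^+ 2 + y ^+ 2)) && (if g is Sph then true else 0 <
    z).

Definition pt (R : realType) (g : geom) : Type :=
  {u : R * R * R | on_surface g u}.

HB.lock Definition X (R : realType) (g : geom) (u : pt R g) : R := (\val u).1.1.
HB.lock Definition Y (R : realType) (g : geom) (u : pt R g) : R := (\val u).1.2.
HB.lock Definition Z (R : realType) (g : geom) (u : pt R g) : R := (\val u).2.

HB.lock Definition md (R : realType) (g : geom) (u v : pt R g) : R :=
  ((X u - X v) ^+ 2 + (Y u - Y v) ^+ 2 + eps g * (Z u - Z v) ^+ 2) / 2.

HB.lock Definition dist (R : realType) (g : geom) (u v : pt R g) : R :=
  arcd g (md u v).

Section Points.
Variables (R : realType) (g : geom).
Local Notation ep := (eps g : R).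
Local Notation pt := (pt R g).

Implicit Types u v w p q a b c : pt.

(** The ambient bilinear form, equal to [cs] of the distance and therefore constantly 1 on the
    plane. *)
Definition pr u v : R := Z u * Z v + ep * (X u * X v + Y u * Y v).

(** Its sign tells on which side of the line through u and v the point w lies. *)
Definition det u v w : R :=
  X u * (Y v * Z w - Z v * Y w) - Y u * (X v * Z w - Z v * X w)
  + Z u * (X v * Y w - Y v * X w).

Definition comb p (s : R) a (t : R) c : Prop :=
  [/\ X p = s * X a + t * X c, Y p = s * Y a + t * Y c &
      Z p = s * Z a + t * Z c].

Definition cone p a c : Prop := exists s t, [/\ 0 <= s, 0 <= t & comb p s a t
  c].

Lemma mdE u v : md u v =
  ((X u - X v) ^+ 2 + (Y u - Y v) ^+ 2 + ep * (Z u - Z v) ^+ 2) / 2.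
Proof. by rewrite md.unlock. Qed.

Lemma distE u v : dist u v = arcd g (md u v).
Proof. by rewrite dist.unlock. Qed.

Lemma pt_ext u v : X u = X v -> Y u = Y v -> Z u = Z v -> u = v.
Proof.
case: u v => [[[x y] z] hu] [[[x' y'] z'] hv];
  rewrite X.unlock Y.unlock Z.unlock /= => ex ey ez.
by apply: val_inj; rewrite /= ex ey ez.
Qed.

Lemma mk_pt x y z : z ^+ 2 = 1 - ep * (x ^+ 2 + y ^+ 2) -> (g <> Sph -> 0 < z)
  ->
  exists u, [/\ X u = x, Y u = y & Z u = z].
Proof.
move=> h1 h2; have h : on_surface g (x, y, z).
  by rewrite /= h1 eqxx /=; case: g h2 => // H; apply: H.
exists (exist (fun u : R * R * R => on_surface g u) (x, y, z) h).
by rewrite X.unlock Y.unlock Z.unlock.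
Qed.

Lemma Z2 u : Z u ^+ 2 = 1 - ep * (X u ^+ 2 + Y u ^+ 2).
Proof.
by case: u => [[[x y] z] hu]; have /andP[/eqP] := hu;
  rewrite X.unlock Y.unlock Z.unlock.
Qed.

Lemma Z_gt0 u : g <> Sph -> 0 < Z u.
Proof. by case: u => [[[x y] z] hu]; have /andP[_] := hu; rewrite Z.unlock /=;
  case: g. Qed.

Lemma Z_Euc u : ep = 0 -> Z u = 1.
Proof.
move=> e0; have gS : g <> Sph by move=> gS; move/eqP: e0;
  rewrite /eps gS oner_eq0.
have Zp := Z_gt0 u gS; have /eqP := Z2 u.
by rewrite e0 mul0r subr0 sqrf_eq1 => /orP[/eqP //|/eqP ZN]; lra.
Qed.

Lemma epsP : [\/ ep = 1, ep = 0 | ep = -1].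
Proof. by rewrite /eps; case: g;
  [constructor 1|constructor 2|constructor 3]. Qed.

Lemma eps_Sph : g = Sph -> ep = 1.
Proof. by move=> ->. Qed.

Lemma eps_nSph : g <> Sph -> ep = 0 \/ ep = -1.
Proof. by rewrite /eps; case: g => // _; [left|right]. Qed.

Lemma SphP : g = Sph \/ g <> Sph.
Proof. by case: g; [left|right|right]. Qed.

Lemma md_curv u v : ep * md u v = 1 - pr u v.
Proof.
rewrite !mdE /pr; have := (Z2 u, Z2 v); have := (@Z_Euc u, @Z_Euc v).
by case: epsP => -> [Hu Hv] [Zu Zv]; [| rewrite Hu ?Hv // |]; lra.
Qed.

Lemma md_sym u v : md u v = md v u.
Proof. rewrite !mdE; ring. Qed.

Lemma mdxx u : md u u = 0.
Proof. by rewrite !mdE !subrr; ring. Qed.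

(** The form is indefinite on the hyperboloid, where this is the reversed Cauchy-Schwarz
    inequality. *)
Lemma md_ge0 u v : 0 <= md u v.
Proof.
have := (Z2 u, Z2 v); have := md_curv u v; rewrite mdE /pr.
have [e|e|e] := epsP; rewrite e => md1 [Hu Hv].
- by apply: divr_ge0 => //; rewrite mul1r !addr_ge0 // sqr_ge0.
- by apply: divr_ge0 => //; rewrite mul0r !addr_ge0 // sqr_ge0.
have gS : g <> Sph by move=> gS; move: e; rewrite /eps gS; lra.
have Zu := Z_gt0 u gS; have Zv := Z_gt0 v gS.
suff : X u * X v + Y u * Y v + 1 <= Z u * Z v by lra.
set L := X u * X v + Y u * Y v + 1.
case: (lerP 0 L) => [L0|L0]; last by apply: ltW; apply: (lt_trans L0);
  apply: mulr_gt0.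
have ZZ0 : 0 <= Z u * Z v by rewrite mulr_ge0 // ltW.
rewrite -(@ler_pXn2r _ 2) ?nnegrE // exprMn Hu Hv /L.
rewrite -subr_ge0.
have -> : (1 - -1 * (X u ^+ 2 + Y u ^+ 2)) * (1 - -1 * (X v ^+ 2 + Y v ^+ 2)) -
   (X u * X v + Y u * Y v + 1) ^+ 2 = (X u - X v) ^+ 2 + (Y u - Y v) ^+ 2
   + (X u * Y v - Y u * X v) ^+ 2 by ring.
by rewrite !addr_ge0 // sqr_ge0.
Qed.

Lemma md_le2 u v : g = Sph -> md u v <= 2.
Proof.
move=> gS; have := md_curv u v; have := (Z2 u, Z2 v).
have := sqr_ge0 (X u + X v); have := sqr_ge0 (Y u + Y v).
have := sqr_ge0 (Z u + Z v); rewrite /pr (eps_Sph gS).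
move=> ? ? ? [? ?] ?; lra.
Qed.

Lemma dist_rng u v : rng g (dist u v).
Proof. by rewrite distE; apply: arcd_rng; [exact: md_ge0|exact: md_le2]. Qed.

Lemma hsq_dist u v : hsq g (dist u v) = md u v.
Proof. by rewrite distE; apply: arcdK; [exact: md_ge0|exact: md_le2]. Qed.

Lemma dist_ge0 u v : 0 <= dist u v.
Proof. by case: (dist_rng u v). Qed.

Lemma dist_sym u v : dist u v = dist v u.
Proof. by rewrite !distE md_sym. Qed.

Lemma dist_eq u v t : rng g t -> md u v = hsq g t -> dist u v = t.
Proof. by move=> rt h; rewrite !distE h arcdE. Qed.

Lemma eq_dist u v u' v' : md u v = md u' v' -> dist u v = dist u' v'.
Proof. by rewrite !distE => ->. Qed.

Lemma distxx u : dist u u = 0.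
Proof.
apply: dist_eq; last by rewrite mdxx hsq0.
by split=> // _; exact: pi_ge0.
Qed.

Lemma le_dist u v u' v' : (dist u v <= dist u' v') = (md u v <= md u' v').
Proof.
by rewrite -(hsq_le (dist_rng u v) (dist_rng u' v')) !hsq_dist.
Qed.

Lemma pr_cs u v : pr u v = cs g (dist u v).
Proof.
have := md_curv u v; have := hsq_curv g (dist u v); rewrite hsq_dist; lra.
Qed.

Lemma pole_on_surface : on_surface g (0, 0, 1 : R).
Proof. by rewrite /= expr0n /= expr1n addr0 mulr0 subr0 eqxx; case: g;
  rewrite /= ?ltr01. Qed.
Definition pole : pt := exist (fun u : R * R * R => on_surface g u) (0, 0, 1)
  pole_on_surface.

Lemma X_pole : X pole = 0. Proof. by rewrite X.unlock. Qed.
Lemma Y_pole : Y pole = 0. Proof. by rewrite Y.unlock. Qed.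
Lemma Z_pole : Z pole = 1. Proof. by rewrite Z.unlock. Qed.

Lemma cone_sym p a c : cone p a c -> cone p c a.
Proof.
move=> [s [t [s0 t0 [hx hy hz]]]]; exists t, s; split=> //.
by split; rewrite addrC.
Qed.

Lemma cone_l a c : cone a a c.
Proof. by exists 1, 0; split=> //; split; ring. Qed.

Lemma cone_r a c : cone c a c.
Proof. exact/cone_sym/cone_l. Qed.

End Points.

(** * Isometries *)

Section Isometries.
Variables (R : realType) (g : geom).
Local Notation ep := (eps g : R).
Local Notation pt := (pt R g).
Local Notation pole := (pole R g).

(** Linearity enters only through the transport of relations [comb], and orientation only through
    the sign [k], so no matrices are needed. *)
Record isom (f fi : pt -> pt) : Prop := Isom {
  isomK : cancel f fi;
  isomVK : cancel fi f;
  isom_md : forall u v, md (f u) (f v) = md u v;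
  isom_comb : forall p s a t c, comb p s a t c -> comb (f p) s (f a) t (f c);
  isom_combV : forall p s a t c,
    comb p s a t c -> comb (fi p) s (fi a) t (fi c);
  isom_det : exists k : R, k ^+ 2 = 1 /\
    forall u v w, det (f u) (f v) (f w) = k * det u v w }.

Lemma isom_comp f fi h hi : isom f fi -> isom h hi ->
  isom (h \o f) (fi \o hi).
Proof.
move=> [fK fiK fmd fc fic [k [k1 fd]]] [hK hiK hmd hc hic [l [l1 hd]]]; split.
- exact: can_comp.
- exact: can_comp.
- by move=> u v; rewrite /= hmd fmd.
- by move=> p s a t c /fc/hc.
- by move=> p s a t c /hic/fic.
by exists (l * k); split=> [|u v w];
  rewrite ?exprMn ?l1 ?k1 ?mulr1 //= hd fd mulrA.
Qed.

Lemma isom_invol f : involutive f ->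
  (forall u v, md (f u) (f v) = md u v) ->
  (forall p s a t c, comb p s a t c -> comb (f p) s (f a) t (f c)) ->
  (exists k : R, k ^+ 2 = 1 /\
    forall u v w, det (f u) (f v) (f w) = k * det u v w) ->
  isom f f.
Proof. by move=> fK fmd fc fd; split. Qed.

(* The half-turn about the midpoint of [pole] and [a]. *)
Lemma half_turn (a : pt) : 0 < 1 + Z a -> exists f, isom f f /\ f a = pole.
Proof.
move=> a1; have a10 : 1 + Z a != 0 by rewrite lt0r_neq0.
have Ea := Z2 a; have Za := @Z_Euc R g a.
(* The half-turn about the axis w = a + pole maps u to l u * w - u with l u = 2 <u, w> / <w, w>, and
   <w, w> = 2 (1 + Z a). *)
pose l u : R := (pr u a + Z u) / (1 + Z a).
have lE u : l u * (1 + Z a) = pr u a + Z u by rewrite /l divfK.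
have lEuc u : ep = 0 -> l u = 1.
  by move=> e0; rewrite /l /pr e0 Za // Z_Euc //; field.
have ex (u : pt) : exists v : pt, [/\ X v = l u * X a - X u, Y v = l u * Y a -
  Y u &
    Z v = l u * (1 + Z a) - Z u].
  apply: mk_pt => [|gS].
    have := lE u; have := Z2 u; rewrite /pr.
    have := lEuc u; have := @Z_Euc R g u.
    set L := l u => Zu L1 Eu LE.
    apply/eqP; rewrite -subr_eq0.
    have -> : (L * (1 + Z a) - Z u) ^+ 2 -
       (1 - ep * ((L * X a - X u) ^+ 2 + (L * Y a - Y u) ^+ 2)) =
       L ^+ 2 * (Z a ^+ 2 - (1 - ep * (X a ^+ 2 + Y a ^+ 2)))
       + (Z u ^+ 2 - (1 - ep * (X u ^+ 2 + Y u ^+ 2)))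
       + 2 * L * (L * (1 + Z a)
          - (Z u * Z a + ep * (X u * X a + Y u * Y a) + Z u)) by ring.
    by rewrite LE Ea Eu !subrr !mulr0 !addr0.
  rewrite lE addrK pr_cs.
  have := md_ge0 u a; have := md_curv u a; rewrite -pr_cs.
  have := Z_Euc u; have := Za; rewrite /pr.
  case: (eps_nSph R gS) => -> Hu Ha; last by lra.
  by rewrite Hu // Ha //; lra.
have [f fP] := choice ex.
have fX u : X (f u) = l u * X a - X u by case: (fP u).
have fY u : Y (f u) = l u * Y a - Y u by case: (fP u).
have fZ u : Z (f u) = l u * (1 + Z a) - Z u by case: (fP u).
have lf u : l (f u) = l u.
  apply: (mulIf a10); rewrite [in LHS]lE /pr fX fY fZ.
  have := lE u; rewrite /pr; set L := l u => LE.
  apply/eqP; rewrite -subr_eq0.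
  have -> : (L * (1 + Z a) - Z u) * Z a +
   ep * ((L * X a - X u) * X a + (L * Y a - Y u) * Y a) +
   (L * (1 + Z a) - Z u) - L * (1 + Z a) =
   L * (Z a ^+ 2 - (1 - ep * (X a ^+ 2 + Y a ^+ 2)))
   + (L * (1 + Z a) - (Z u * Z a + ep * (X u * X a + Y u * Y a) + Z u)) by ring.
  by rewrite Ea LE !subrr mulr0 addr0.
exists f; split; last first.
  have la : l a = 1.
    apply: (mulIf a10); rewrite lE /pr mul1r.
    have := Ea => E; ring: E.
  by apply: pt_ext; rewrite ?fX ?fY ?fZ la ?X_pole ?Y_pole ?Z_pole; ring.
apply: isom_invol.
- by move=> u; apply: pt_ext; rewrite ?fX ?fY ?fZ lf ?fX ?fY ?fZ; ring.
- move=> u v; rewrite !mdE !fX !fY !fZ.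
  have := lE u; have := lE v; have := lEuc u; have := lEuc v.
  rewrite /pr; set L := l u; set M := l v => M1 L1 ME LE.
  have [e|e|e] := epsP R g; rewrite e in Ea LE ME *.
  + have {}LE : (L - M) * (1 + Z a) = Z u * Z a + (X u * X a + Y u * Y a) + Z u
      - (Z v * Z a + (X v * X a + Y v * Y a) + Z v) by rewrite mulrBl LE ME;
          ring.
    apply/eqP; rewrite -subr_eq0; apply/eqP.
    transitivity ((L - M) * ((L - M) * (1 + Z a) - ( Z u * Z a + (X u * X a + Y
      u * Y a) + Z u
      - (Z v * Z a + (X v * X a + Y v * Y a) + Z v)))
      + (L - M) ^+ 2 / 2 * (Z a ^+ 2 - (1 - 1 * (X a ^+ 2 + Y a ^+ 2)))).
      by field.
    by rewrite LE Ea !subrr !mulr0 addr0.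
  + by rewrite M1 // L1 //; field.
  have {}LE : (L - M) * (1 + Z a) = Z u * Z a - (X u * X a + Y u * Y a) + Z u
      - (Z v * Z a - (X v * X a + Y v * Y a) + Z v) by rewrite mulrBl LE ME;
          ring.
  apply/eqP; rewrite -subr_eq0; apply/eqP.
  transitivity (- (L - M) * ((L - M) * (1 + Z a) - ( Z u * Z a - (X u * X a + Y
    u * Y a) + Z u
      - (Z v * Z a - (X v * X a + Y v * Y a) + Z v)))
      - (L - M) ^+ 2 / 2 * (Z a ^+ 2 - (1 - -1 * (X a ^+ 2 + Y a ^+ 2)))).
    by field.
  by rewrite LE Ea !subrr !mulr0 subr0.
- move=> p s b t c [hx hy hz]; split; rewrite ?fX ?fY ?fZ /l /pr hx hy hz; ring.
exists 1; split=> [|u v w]; first by rewrite expr1n.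
rewrite mul1r /det !fX !fY !fZ.
have := lE u; have := lE v; have := lE w.
rewrite /pr; set L := l u; set M := l v; set N := l w => NE ME LE.
apply: (mulIf a10); apply/eqP; rewrite -subr_eq0; apply/eqP.
pose D3 x y z x' y' z' x'' y'' z'' : R := x * (y' * z'' - z' * y'') - y * (x' *
  z'' - z' * x'') + z * (x' * y'' - y' * x'').
have -> : L = (Z u * Z a + ep * (X u * X a + Y u * Y a) + Z u) / (1 + Z a) by
  rewrite -LE mulfK.
have -> : M = (Z v * Z a + ep * (X v * X a + Y v * Y a) + Z v) / (1 + Z a) by
  rewrite -ME mulfK.
have -> : N = (Z w * Z a + ep * (X w * X a + Y w * Y a) + Z w) / (1 + Z a) by
  rewrite -NE mulfK.
by field: Ea.
Qed.

(** Covers the antipode of the pole, for which [half_turn] has no axis. *)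
Lemma half_turn_x : g = Sph -> exists f, isom f f /\
  forall u, Z (f u) = - Z u.
Proof.
move=> gS; have e1 : ep = 1 by rewrite /eps gS.
have ex (u : pt) : exists v : pt, [/\ X v = X u, Y v = - Y u & Z v = - Z u].
  by apply: mk_pt => [|/(_ gS) []]; rewrite !sqrrN Z2.
have [f fP] := choice ex.
have fX u : X (f u) = X u by case: (fP u).
have fY u : Y (f u) = - Y u by case: (fP u).
have fZ u : Z (f u) = - Z u by case: (fP u).
exists f; split=> //; apply: isom_invol.
- by move=> u; apply: pt_ext; rewrite ?fX ?fY ?fZ ?opprK // fX.
- by move=> u v; rewrite !mdE !fX !fY !fZ; field.
- by move=> p s b t c [hx hy hz]; split; rewrite ?fX ?fY ?fZ ?hx ?hy ?hz; ring.
exists 1; split=> [|u v w]; first by rewrite expr1n.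
by rewrite /det !fX !fY !fZ; ring.
Qed.

Lemma to_pole (a : pt) : exists f fi, isom f fi /\ f a = pole.
Proof.
have [a1|a1] := ltrP 0 (1 + Z a).
  by have [f [fI fa]] := half_turn a1; exists f, f.
case: (SphP g) => [gS|gN]; last by have := Z_gt0 a gN; lra.
have [f [fI fZ]] := half_turn_x gS.
have fa1 : 0 < 1 + Z (f a) by rewrite fZ; lra.
have [h [hI ha]] := half_turn fa1.
by exists (h \o f), (f \o h); split=> //; exact: isom_comp.
Qed.

(** A reflection in a line through the pole is used instead of a rotation because it is its own
    inverse; it reverses orientation. *)
Lemma align (c : pt) : exists f,
  [/\ isom f f, f pole = pole, Y (f c) = 0 & 0 <= X (f c)].
Proof.
pose s := Num.sqrt (X c ^+ 2 + Y c ^+ 2).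
have s2 : s ^+ 2 = X c ^+ 2 + Y c ^+ 2 by rewrite sqr_sqrtr // addr_ge0 //
  sqr_ge0.
have [C [S [CS1 CS2 CS3]]] : exists C S : R,
    [/\ C ^+ 2 + S ^+ 2 = 1, S * X c - C * Y c = 0 & 0 <= C * X c + S * Y c].
  have [s0|s0] := eqVneq s 0.
    exists 1, 0; move: s2; rewrite s0 expr0n /= => H.
    have := sqr_ge0 (X c); have := sqr_ge0 (Y c) => hy hx.
    have /eqP : X c ^+ 2 = 0 by lra.
    have /eqP : Y c ^+ 2 = 0 by lra.
    by rewrite !sqrf_eq0 => /eqP-> /eqP->; split; lra.
  exists (X c / s), (Y c / s); split.
  - by rewrite !exprMn -mulrDl -s2 -exprMn divff // expr1n.
  - by ring.
  have -> : X c / s * X c + Y c / s * Y c = (X c ^+ 2 + Y c ^+ 2) / s by ring.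
  by rewrite -s2 expr2 mulfK // sqrtr_ge0.
have ex (u : pt) : exists v : pt,
    [/\ X v = C * X u + S * Y u, Y v = S * X u - C * Y u & Z v = Z u].
  apply: mk_pt => [|gS]; last exact: Z_gt0.
  have -> : (C * X u + S * Y u) ^+ 2 + (S * X u - C * Y u) ^+ 2 =
    (C ^+ 2 + S ^+ 2) * (X u ^+ 2 + Y u ^+ 2) by ring.
  by rewrite CS1 mul1r Z2.
have [f fP] := choice ex.
have fX u : X (f u) = C * X u + S * Y u by case: (fP u).
have fY u : Y (f u) = S * X u - C * Y u by case: (fP u).
have fZ u : Z (f u) = Z u by case: (fP u).
have C2 : C ^+ 2 = 1 - S ^+ 2 by lra.
exists f; split; [| |by rewrite fY|by rewrite fX].
- apply: isom_invol.
  + by move=> u; apply: pt_ext; rewrite ?fX ?fY ?fZ ?fX ?fY ?fZ //; ring: C2.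
  + by move=> u v; rewrite !mdE !fX !fY !fZ; field: C2.
  + by move=> p s' b t d [hx hy hz]; split; rewrite ?fX ?fY ?fZ ?hx ?hy ?hz;
      ring.
  exists (-1); split=> [|u v w]; first by rewrite sqrrN expr1n.
  by rewrite /det !fX !fY !fZ; ring: C2.
by apply: pt_ext; rewrite ?fX ?fY ?fZ ?X_pole ?Y_pole ?Z_pole; ring.
Qed.

Lemma normalize (a c : pt) : exists f fi,
  [/\ isom f fi, f a = pole, Y (f c) = 0 & 0 <= X (f c)].
Proof.
have [f [fi [fI fa]]] := to_pole a.
have [h [hI hp hY hX]] := align (f c).
by exists (h \o f), (fi \o h); split=> //=; [exact: isom_comp|rewrite fa].
Qed.

Lemma isom_dist f fi u v : isom f fi -> dist (f u) (f v) = dist u v.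
Proof. by move=> [_ _ fmd _ _ _]; apply: eq_dist. Qed.

Lemma isom_cone f fi p a c : isom f fi -> cone (f p) (f a) (f c) <-> cone p a c.
Proof.
move=> [fK _ _ fc fic _]; split=> -[s [t [s0 t0 H]]]; exists s, t; split=> //.
  by have := fic _ _ _ _ _ H; rewrite !fK.
exact: fc.
Qed.

End Isometries.

(** * Segments and the triangle inequality *)

Section Segments.
Variables (R : realType) (g : geom).
Local Notation ep := (eps g : R).
Local Notation pt := (pt R g).
Local Notation pole := (pole R g).
Implicit Types a c p u v w b y : pt.

Lemma polar u : Z u = cs g (dist pole u) /\
  X u ^+ 2 + Y u ^+ 2 = sn g (dist pole u) ^+ 2.
Proof.
have ZE : Z u = cs g (dist pole u).
  by rewrite -pr_cs /pr X_pole Y_pole Z_pole; ring.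
split=> //; have := hsq_dist pole u; rewrite hsqE -ZE !mdE X_pole Y_pole Z_pole.
by rewrite !sub0r !sqrrN; lra.
Qed.

(** Law of cosines at the pole. The last two terms cancel exactly when u and v lie in opposite
    directions. *)
Lemma md_polar u v : md u v = hsq g (dist pole u + dist pole v)
   - sn g (dist pole u) * sn g (dist pole v) - (X u * X v + Y u * Y v).
Proof.
have [Zu Ru] := polar u; have [Zv Rv] := polar v.
by rewrite hsqD -Zu -Zv -Ru -Rv !mdE; field.
Qed.

Lemma sn_dist_ge0 u v : 0 <= sn g (dist u v).
Proof. exact/sn_ge0/dist_rng. Qed.

Lemma CS2 (x y x' y' r s : R) : 0 <= r -> 0 <= s ->
  x ^+ 2 + y ^+ 2 = r ^+ 2 -> x' ^+ 2 + y' ^+ 2 = s ^+ 2 ->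
  `|x * x' + y * y'| <= r * s.
Proof.
move=> r0 s0 hr hs; rewrite -(@ler_pXn2r _ 2) ?nnegrE ?mulr_ge0 //.
rewrite real_normK ?num_real // exprMn -hr -hs -subr_ge0.
have -> : (x ^+ 2 + y ^+ 2) * (x' ^+ 2 + y' ^+ 2) - (x * x' + y * y') ^+ 2 =
  (x * y' - y * x') ^+ 2 by ring.
exact: sqr_ge0.
Qed.

(** With v at the pole this is the law of cosines and Cauchy-Schwarz; a sum beyond pi on the sphere
    bounds every distance. *)
Lemma dist_triangle v u w : dist u w <= dist u v + dist v w.
Proof.
wlog -> : v u w / v = pole.
  move=> H; have [f [fi [fI fv]]] := to_pole v.
  by rewrite -(isom_dist u w fI) -(isom_dist u v fI) -(isom_dist v w fI) fv;
    apply: H.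
rewrite (dist_sym u pole); set r := dist pole u; set s := dist pole w.
have rs0 : 0 <= r + s by rewrite addr_ge0 ?dist_ge0.
have h : md u w <= hsq g (r + s).
  rewrite md_polar -/r -/s; have [_ Ru] := polar u; have [_ Rw] := polar w.
  have := CS2 (sn_dist_ge0 pole u) (sn_dist_ge0 pole w) Ru Rw.
  by rewrite ler_norml => /andP[]; rewrite -/r -/s; lra.
have [rs|rs] := pselect (rng g (r + s)).
  by rewrite -(hsq_le (dist_rng u w) rs) hsq_dist.
have [gS|gS] := SphP g; last by case: rs; split.
have [_ /(_ gS) up] := dist_rng u w.
by rewrite leNgt; apply/negP => lt; apply: rs; split=> // _; lra.
Qed.

Lemma dist0_eq u v : dist u v = 0 -> u = v.
Proof.
have [f [fi [fI fu]]] := to_pole u.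
rewrite -(isom_dist u v fI) fu => d0; apply: (can_inj (isomK fI)); rewrite fu.
have [Zv Rv] := polar (f v); rewrite d0 cs0 sn0 expr0n /= in Zv Rv.
have := sqr_ge0 (X (f v)); have := sqr_ge0 (Y (f v)) => hy hx.
have /eqP : X (f v) ^+ 2 = 0 by lra.
have /eqP : Y (f v) ^+ 2 = 0 by lra.
by rewrite !sqrf_eq0 => /eqP Y0 /eqP X0; apply: pt_ext;
  rewrite ?X_pole ?Y_pole ?Z_pole ?X0 ?Y0 ?Zv.
Qed.

Lemma dist_gt0 u v : u <> v -> 0 < dist u v.
Proof.
by move=> uv; rewrite lt_neqAle dist_ge0 andbT eq_sym; apply/eqP => /dist0_eq.
Qed.

Lemma ray_pole : exists h : R -> pt,
  forall t, [/\ X (h t) = sn g t, Y (h t) = 0 & Z (h t) = cs g t].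
Proof.
have ex (t : R) : exists u : pt, [/\ X u = sn g t, Y u = 0 & Z u = cs g t].
  apply: mk_pt; last exact: cs_gt0.
  by rewrite cs2 expr0n addr0.
by have [h hP] := choice ex; exists h.
Qed.

Lemma line a c : exists h : R -> pt,
  [/\ h 0 = a, h (dist a c) = c, forall s t, md (h s) (h t) = hsq g (s - t),
    (0 < sn g (dist a c) -> forall t, comb (h t)
      (sn g (dist a c - t) / sn g (dist a c)) a (sn g t / sn g (dist a c)) c) &
    (small g (dist a c) -> forall p, cone p a c ->
      exists2 t, 0 <= t <= dist a c & p = h t)].
Proof.
have [f [fi [fI fa Yc Xc]]] := normalize a c.
have [h hP] := ray_pole.
have hX t : X (h t) = sn g t by case: (hP t).
have hY t : Y (h t) = 0 by case: (hP t).
have hZ t : Z (h t) = cs g t by case: (hP t).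
have [Zc Rc] := polar (f c).
have D : dist pole (f c) = dist a c by rewrite -fa (isom_dist _ _ fI).
rewrite D in Zc Rc; set d := dist a c in D Zc Rc *.
have d0 : 0 <= sn g d by exact: sn_dist_ge0.
have XcE : X (f c) = sn g d.
  by apply: (pexpIrn (n := 2)) => //; rewrite ?nnegrE // -Rc Yc expr0n addr0.
have hpole : h 0 = pole.
  by apply: pt_ext; rewrite ?hX ?hY ?hZ ?sn0 ?cs0 ?X_pole ?Y_pole ?Z_pole.
have hfc : h d = f c by apply: pt_ext; rewrite ?hX ?hY ?hZ.
have combh : 0 < sn g d -> forall t,
    comb (h t) (sn g (d - t) / sn g d) pole (sn g t / sn g d) (f c).
  move=> sd t; split; rewrite ?hX ?hY ?hZ ?Zc ?Yc ?XcE ?X_pole ?Y_pole ?Z_pole.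
  - by field; rewrite lt0r_neq0.
  - by ring.
  rewrite snD csN snN; by field; exact: lt0r_neq0.
have [fK fVK fmd fc fic _] := fI.
exists (fi \o h); split=> /=.
- by rewrite hpole -fa fK.
- by rewrite hfc fK.
- by move=> s t; rewrite -fmd !fVK !mdE !hX !hY !hZ hsqB; field.
- by move=> sd t; have := fic _ _ _ _ _ (combh sd t); rewrite -fa !fK.
move=> sm p /(isom_cone _ _ _ fI); rewrite fa => -[s [t [s0 t0 [Xp Yp Zp]]]].
rewrite XcE Yc Zc X_pole Y_pole Z_pole in Xp Yp Zp.
have Yp0 : Y (f p) = 0 by rewrite Yp; ring.
have Xp' : X (f p) = t * sn g d by rewrite Xp; ring.
have Zp' : Z (f p) = s + t * cs g d by rewrite Zp; ring.
have [ZP RP] := polar (f p); set r := dist pole (f p) in ZP RP.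
have r0 : 0 <= sn g r by exact: sn_dist_ge0.
have XpE : X (f p) = sn g r.
  apply: (pexpIrn (n := 2)) => //; rewrite ?nnegrE //; last first.
    by rewrite -RP Yp0 expr0n addr0.
  by rewrite Xp' mulr_ge0.
exists r; last first.
  rewrite -[LHS]fK; congr fi; apply: pt_ext; by rewrite ?hX ?hY ?hZ.
rewrite dist_ge0 /= leNgt; apply/negP => dr.
have [d00|d00] := eqVneq d 0.
  rewrite d00 sn0 cs0 in XpE Xp' Zp'.
  have : 0 < sn g r.
    apply: sn_gt0; first by rewrite -d00.
    move=> gS; rewrite lt_neqAle; have [_ /(_ gS) ->] := dist_rng pole (f p).
    rewrite andbT; apply/eqP => rpi.
    by have := ZP; rewrite Zp' rpi cs_pi //; lra.
  by rewrite -XpE Xp' mulr0 ltxx.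
have dp : 0 < d by rewrite lt_neqAle eq_sym d00 dist_ge0.
have sd : 0 < sn g d by exact: sn_gt0.
(* The coordinates of p give sn (r - d) = - s * sn d, so p cannot lie beyond c. *)
have : 0 < sn g (r - d).
  apply: sn_gt0; first by lra.
  by move=> gS; have [_ /(_ gS)] := dist_rng pole (f p); rewrite -/r; lra.
rewrite snD csN snN -XpE -ZP Xp' Zp';
  have : 0 <= s * sn g d by rewrite mulr_ge0.
nra.
Qed.

Lemma dist_between p a c : small g (dist a c) -> cone p a c ->
  dist a p + dist p c = dist a c.
Proof.
move=> sm; have [h [h0 hd hmd _ /(_ sm p) hp]] := line a c.
move=> /hp [t /andP[t0 td] ->]; have [_ dpi] := dist_rng a c.
have E s r : 0 <= s <= r -> r <= dist a c -> dist (h s) (h r) = r - s.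
  move=> /andP[s0 sr] rd; apply: dist_eq; last by rewrite hmd -hsqN opprB.
  by split=> [|/dpi]; lra.
have E1 : dist a (h t) = t by rewrite -h0 E ?lexx ?t0 ?subr0.
have E2 : dist (h t) c = dist a c - t by rewrite -[in LHS]hd E ?lexx ?t0.
by rewrite E1 E2; ring.
Qed.

Lemma segment_pt a c r : small g (dist a c) -> 0 <= r <= dist a c ->
  exists p, [/\ cone p a c, dist a p = r & dist p c = dist a c - r].
Proof.
move=> sm /andP[r0 rd].
have [h [h0 hd hmd hc _]] := line a c.
have [_ dpi] := dist_rng a c.
have E s t : 0 <= s <= t -> t <= dist a c -> dist (h s) (h t) = t - s.
  move=> /andP[s0 st] td; apply: dist_eq; last by rewrite hmd -hsqN opprB.
  by split=> [|/dpi]; lra.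
exists (h r); split; last 2 first.
- by rewrite -h0 E ?lexx ?r0 ?subr0.
- by rewrite -[in LHS]hd E ?lexx ?r0.
have [d0|d0] := eqVneq (dist a c) 0.
  have -> : r = 0 by lra.
  by rewrite h0; exact: cone_l.
have dp : 0 < dist a c by rewrite lt_neqAle eq_sym d0 dist_ge0.
have sd : 0 < sn g (dist a c) by exact: sn_gt0.
exists (sn g (dist a c - r) / sn g (dist a c)), (sn g r / sn g (dist a c)).
split; last exact: hc.
  by apply: divr_ge0; apply: sn_ge0; split=> [|/dpi]; lra.
by apply: divr_ge0; apply: sn_ge0; split=> [|/dpi]; lra.
Qed.

Lemma pr_gtN1 u v : small g (dist u v) -> -1 < pr u v.
Proof. by move=> sm; rewrite pr_cs; apply: cs_gtN1 => //; exact: dist_rng. Qed.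

(** Central projection of s a + t c to the surface: [k] is the inverse of the norm, which is
    positive because a and c are not antipodal. *)
Lemma comb_pt a c s t : small g (dist a c) -> 0 <= s -> 0 <= t -> 0 < s + t ->
  exists p k, [/\ 0 < k, comb p (k * s) a (k * t) c &
    k ^+ 2 * (s ^+ 2 + t ^+ 2 + 2 * s * t * pr a c) = 1].
Proof.
move=> /pr_gtN1 c1 s0 t0 st.
pose N := s ^+ 2 + t ^+ 2 + 2 * s * t * pr a c.
have N0 : 0 < N.
  have -> : N = (s - t) ^+ 2 + 2 * (s * t) * (1 + pr a c) by rewrite /N; ring.
  have [st0|st0] := eqVneq (s * t) 0.
    rewrite st0 mulr0 mul0r addr0 exprn_even_gt0 //=; apply/negP => /eqP E.
    move/eqP: st0; rewrite mulf_eq0 => /orP[/eqP|/eqP]; lra.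
  have : 0 < s * t by rewrite lt_neqAle eq_sym st0 mulr_ge0.
  move=> st1; apply: ltr_wpDl; first exact: sqr_ge0.
  by apply: mulr_gt0; [apply: mulr_gt0|lra].
pose k := (Num.sqrt N)^-1.
have k0 : 0 < k by rewrite invr_gt0 sqrtr_gt0.
have kN : k ^+ 2 * N = 1.
  by rewrite exprVn sqr_sqrtr ?ltW // mulVf // lt0r_neq0.
have [] := @mk_pt R g (k * s * X a + k * t * X c) (k * s * Y a + k * t * Y c)
  (k * s * Z a + k * t * Z c).
- rewrite -kN /N /pr; have := Z2 a; have := Z2 c => Ec Ea.
  by ring: Ea Ec.
- move=> gS; have Za := Z_gt0 a gS; have Zc := Z_gt0 c gS.
  rewrite -!mulrA -mulrDr mulr_gt0 //.
  have : 0 <= s * Z a by rewrite mulr_ge0 // ltW.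
  have : 0 <= t * Z c by rewrite mulr_ge0 // ltW.
  have [s1|s1] := ltrP 0 s; first by have := mulr_gt0 s1 Za; lra.
  have t1 : 0 < t by lra.
  have := mulr_gt0 t1 Zc; lra.
by move=> p [hx hy hz]; exists p, k; split.
Qed.

End Segments.

(** * Crossing segments *)

Section Crossing.
Variables (R : realType) (g : geom).
Local Notation ep := (eps g : R).
Local Notation pt := (pt R g).
Implicit Types a c p u v w b y qa qc qb qy : pt.

Lemma pr_combr u p a c (s t : R) : comb p s a t c ->
  pr u p = s * pr u a + t * pr u c.
Proof. by case=> hx hy hz; rewrite /pr hx hy hz; ring. Qed.

Lemma pr_sym u v : pr u v = pr v u.
Proof. by rewrite /pr; ring. Qed.

Lemma prxx u : pr u u = 1.
Proof. by rewrite pr_cs distxx cs0. Qed.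

Lemma comb_norm p a c (s t : R) : comb p s a t c ->
  s ^+ 2 + t ^+ 2 + 2 * s * t * pr a c = 1.
Proof.
case=> hx hy hz; have := (Z2 a, Z2 c, prxx p).
by rewrite /pr hx hy hz => -[[Ea Ec] E]; rewrite -[RHS]E; ring: Ea Ec.
Qed.

(** The witness divides [qa, qc] with the coefficients of p, up to the normalising factor [k]. In
    the plane the claim is Stewart's theorem. In the hyperbolic case [pr] is linear in the
    combination, and k <= 1 because a longer base gives s qa + t qc a larger norm. *)
Lemma nSph_crossing_pt p a c qa qc : g <> Sph -> cone p a c ->
  md a c <= md qa qc ->
  exists p', forall b qb, md qb qa <= md b a -> md qb qc <= md b c ->
    md qb p' <= md b p.
Proof.
move=> gS [s [t [s0 t0 h]]] ac.
have st : 0 < s + t.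
  rewrite lt_neqAle addr_ge0 // andbT eq_sym; apply/eqP => st.
  have := Z_gt0 p gS; case: h => _ _ ->.
  have -> : s = 0 by lra.
  by have -> : t = 0; lra.
have [//|p' [k [k0 h' kN]]] := @comb_pt R g qa qc s t _ s0 t0 st.
have N1 := comb_norm h.
exists p' => b qb ba bc.
have := eps_nSph R gS; have := (md_curv a c, md_curv qa qc) => -[].
case=> [M1 M2] [e|e]; rewrite e in M1 M2.
  have k1 : k = 1.
    have st1 : s + t = 1.
      by have := Z_Euc p e; case: h => _ _ ->; rewrite !Z_Euc // !mulr1.
    have := Z_Euc p' e; case: h' => _ _ ->;
      rewrite !Z_Euc // !mulr1 -mulrDr st1.
    by rewrite mulr1.
  have st1 : s = 1 - t.
    by have := Z_Euc p e; case: h => _ _ ->; rewrite !Z_Euc // !mulr1; lra.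
  have stewart w v x z : comb x s w t z -> 
     md v x = s * md v w + t * md v z - s * t * md w z.
    by case=> hx hy hz; rewrite !mdE hx hy hz e st1; field.
  rewrite k1 !mul1r in h'.
  rewrite (stewart _ _ _ _ h) (stewart _ _ _ _ h').
  have : s * t * md a c <= s * t * md qa qc by rewrite ler_wpM2l // mulr_ge0.
  have : s * md qb qa <= s * md b a by rewrite ler_wpM2l.
  have : t * md qb qc <= t * md b c by rewrite ler_wpM2l.
  lra.
have k1 : k <= 1.
  have k2 : k ^+ 2 <= 1.
    rewrite -[leRHS]kN; apply: ler_peMr; first exact: sqr_ge0.
    by rewrite -[leLHS]N1 lerD2l ler_wpM2l ?mulr_ge0 //; lra.
  by move: k2; rewrite expr_le1 // ltW.
have prmd u v : md u v = pr u v - 1.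
  by have := md_curv u v; rewrite e; lra.
rewrite !prmd lerD2r (pr_combr _ h) (pr_combr _ h') -!mulrA -mulrDr.
rewrite !prmd !lerD2r in ba bc.
have pr0 u v : 0 <= pr u v by have := md_ge0 u v; rewrite prmd; lra.
apply: (@le_trans _ _ (s * pr qb qa + t * pr qb qc)).
  by rewrite ler_piMl // addr_ge0 // mulr_ge0.
by rewrite lerD // ler_wpM2l.
Qed.

(* The squared norm of [s a + t c - s' b - t' y].  On the sphere it replaces the
   argument of [nSph_crossing_pt], which fails for distances beyond [pi / 2]. *)
Definition sph_form (s t s' t' : R) a c b y : R :=
  s ^+ 2 + t ^+ 2 + s' ^+ 2 + t' ^+ 2 + 2 * (s * t) * pr a c
  + 2 * (s' * t') * pr b y - 2 * (s * s') * pr a b - 2 * (s * t') * pr a y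
  - 2 * (t * s') * pr c b - 2 * (t * t') * pr c y.

Lemma sph_formE s t s' t' a c b y : ep = 1 ->
  sph_form s t s' t' a c b y =
  (s * X a + t * X c - (s' * X b + t' * X y)) ^+ 2
  + (s * Y a + t * Y c - (s' * Y b + t' * Y y)) ^+ 2
  + (s * Z a + t * Z c - (s' * Z b + t' * Z y)) ^+ 2.
Proof.
move=> e; have n u : X u ^+ 2 + Y u ^+ 2 + Z u ^+ 2 = 1 by rewrite Z2 e; ring.
rewrite /sph_form /pr e; apply/eqP; rewrite -subr_eq0; apply/eqP.
transitivity (s ^+ 2 * (1 - (X a ^+ 2 + Y a ^+ 2 + Z a ^+ 2))
  + t ^+ 2 * (1 - (X c ^+ 2 + Y c ^+ 2 + Z c ^+ 2))
  + s' ^+ 2 * (1 - (X b ^+ 2 + Y b ^+ 2 + Z b ^+ 2))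
  + t' ^+ 2 * (1 - (X y ^+ 2 + Y y ^+ 2 + Z y ^+ 2))); first by ring.
by rewrite !n !subrr !mulr0 !addr0.
Qed.

(** The added term cancels the dependence on the pair b, y; each remaining [pr] enters with a
    coefficient of the sign that matches its hypothesis. *)
Lemma sph_form_le s t s' t' a c b y qa qc qb qy : ep = 1 ->
  0 <= s -> 0 <= t -> 0 <= s' -> 0 <= t' ->
  md a c <= md qa qc -> md qb qa <= md b a -> md qb qc <= md b c ->
  md qy qa <= md y a -> md qy qc <= md y c ->
  sph_form s t s' t' qa qc qb qy + 2 * (s' * t') * md qb qy <=
  sph_form s t s' t' a c b y + 2 * (s' * t') * md b y.
Proof.
move=> e s0 t0 s'0 t'0 ac ba bc ya yc.
have prmd u v : pr u v = 1 - md u v by have := md_curv u v; rewrite e; lra.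
rewrite /sph_form !prmd (md_sym qa qb) (md_sym qa qy) (md_sym qc qb) (md_sym qc
  qy).
rewrite (md_sym a b) (md_sym a y) (md_sym c b) (md_sym c y).
have : s * t * md a c <= s * t * md qa qc by rewrite ler_wpM2l // mulr_ge0.
have : s * s' * md qb qa <= s * s' * md b a by rewrite ler_wpM2l // mulr_ge0.
have : t * s' * md qb qc <= t * s' * md b c by rewrite ler_wpM2l // mulr_ge0.
have : s * t' * md qy qa <= s * t' * md y a by rewrite ler_wpM2l // mulr_ge0.
have : t * t' * md qy qc <= t * t' * md y c by rewrite ler_wpM2l // mulr_ge0.
lra.
Qed.

(** Here t' = 0, so the form does not see the pair b, y. But its vanishing forces qb = s qa + t qc,
    and the claim becomes linear. *)
Lemma sph_crossing_deg a c b y qa qc qb qy : g = Sph -> cone b a c ->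
  md a c <= md qa qc -> md qb qa <= md b a -> md qb qc <= md b c ->
  md qy qa <= md y a -> md qy qc <= md y c ->
  md qb qy <= md b y.
Proof.
move=> /(eps_Sph R) e [s [t [s0 t0 h]]] ac ba bc ya yc.
have := sph_form_le e s0 t0 ler01 (lexx 0) ac ba bc ya yc.
rewrite !mulr0 !mul0r !addr0 !sph_formE //.
case: (h) => hx hy hz;
  rewrite -hx -hy -hz !mul0r !addr0 !mul1r !subrr !expr0n /= !addr0 => H.
have := sqr_ge0 (s * X qa + t * X qc - X qb).
have := sqr_ge0 (s * Y qa + t * Y qc - Y qb).
have := sqr_ge0 (s * Z qa + t * Z qc - Z qb) => z0 y0 x0.
have /eqP : (s * X qa + t * X qc - X qb) ^+ 2 = 0 by lra.
have /eqP : (s * Y qa + t * Y qc - Y qb) ^+ 2 = 0 by lra.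
have /eqP : (s * Z qa + t * Z qc - Z qb) ^+ 2 = 0 by lra.
rewrite !sqrf_eq0 !subr_eq0 => /eqP Ez /eqP Ey /eqP Ex.
have h' : comb qb s qa t qc by split.
have prmd u v : md u v = 1 - pr u v by have := md_curv u v; rewrite e; lra.
rewrite !prmd !lerD2l !lerN2 in ya yc *.
rewrite (pr_sym b) (pr_sym qb) (pr_combr _ h) (pr_combr _ h').
by rewrite lerD // ler_wpM2l.
Qed.

(** At a crossing point s a + t c = s' b + t' y, so the form vanishes on the original points. It is
    nonnegative on the new ones, which leaves the inequality for [b, y] multiplied by s' t'. *)
Lemma sph_crossing p a c b y qa qc qb qy : g = Sph ->
  cone p a c -> cone p b y ->
  md a c <= md qa qc -> md qb qa <= md b a -> md qb qc <= md b c ->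
  md qy qa <= md y a -> md qy qc <= md y c ->
  md qb qy <= md b y.
Proof.
move=> gS pac [s' [t' [s'0 t'0 h']]] ac ba bc ya yc.
have e := eps_Sph R gS.
have one (r : R) u : 0 <= r -> X p = r * X u -> Y p = r * Y u -> Z p = r * Z u
  -> p = u.
  move=> r0 hx hy hz; have := prxx p; rewrite /pr hx hy hz => E.
  have := prxx u; rewrite /pr => E'.
  have /eqP : r ^+ 2 = 1.
    transitivity (r ^+ 2 * (Z u * Z u + ep * (X u * X u + Y u * Y u))).
      by rewrite E' mulr1.
    by rewrite -[RHS]E; ring.
  rewrite sqrf_eq1 => /orP[/eqP r1|/eqP r1]; last first.
    by move: r0; rewrite r1 oppr_ge0 ler10.
  by apply: pt_ext; rewrite ?hx ?hy ?hz r1 mul1r.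
have [s00|s00] := eqVneq s' 0.
  have py : p = y by case: h' => hx hy hz; apply: (one t') => //;
    rewrite ?hx ?hy ?hz s00 mul0r add0r.
  by rewrite (md_sym qb) (md_sym b); apply: sph_crossing_deg ac ya yc ba bc;
    rewrite -?py.
have [t00|t00] := eqVneq t' 0.
  have pb : p = b by case: h' => hx hy hz; apply: (one s') => //;
    rewrite ?hx ?hy ?hz t00 mul0r addr0.
  by apply: sph_crossing_deg ac ba bc ya yc; rewrite -?pb.
have st0 : 0 < 2 * (s' * t').
  by rewrite mulr_gt0 // mulr_gt0 // lt_neqAle eq_sym ?s00 ?t00.
rewrite -(ler_pM2l st0).
case: pac => s [t [s0 t0 [hx hy hz]]].
have := sph_form_le e s0 t0 s'0 t'0 ac ba bc ya yc.
rewrite !sph_formE //; case: h' => hx' hy' hz'.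
rewrite -hx -hx' -hy -hy' -hz -hz' !subrr !expr0n /= !addr0 add0r.
apply: le_trans; rewrite lerDr.
by rewrite !addr_ge0 // sqr_ge0.
Qed.

(** Off the sphere one point p' of the new base bounds both halves of the new segment, whose length
    is then estimated through p'. *)
Lemma crossing p a c b y qa qc qb qy :
  cone p a c -> cone p b y ->
  dist a c <= dist qa qc -> dist qb qa <= dist b a -> dist qb qc <= dist b c ->
  dist qy qa <= dist y a -> dist qy qc <= dist y c ->
  dist qb qy <= dist b y.
Proof.
move=> pac pby; rewrite !le_dist => ac ba bc ya yc.
have [gS|gS] := SphP g; first exact: sph_crossing pac pby ac ba bc ya yc.
have sm : small g (dist b y) by move=> /gS.
have [p' hp'] := nSph_crossing_pt gS pac ac.
have := hp' _ _ ba bc; have := hp' _ _ ya yc; rewrite -!le_dist => h1 h2.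
apply: (le_trans (dist_triangle p' qb qy)).
by rewrite -(dist_between sm pby) (dist_sym p' qy) (dist_sym p y) lerD.
Qed.

Definition cross a c b y : Prop := exists p, cone p a c /\ cone p b y.

Lemma cross_sym a c b y : cross a c b y -> cross b y a c.
Proof. by case=> p [h1 h2]; exists p. Qed.

Lemma cross_flip a c b y : cross a c b y -> cross c a b y.
Proof. by case=> p [/cone_sym h1 h2]; exists p. Qed.

Lemma cone_trans p a c b y : cone p a c -> cone a b y -> cone c b y -> cone p b
  y.
Proof.
move=> [s [t [s0 t0 [px py pz]]]] [s1 [t1 [s10 t10 [ax ay az]]]].
move=> [s2 [t2 [s20 t20 [cx cy cz]]]].
exists (s * s1 + t * s2), (s * t1 + t * t2); split;
  try by rewrite addr_ge0 // mulr_ge0.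
by split; rewrite ?px ?py ?pz ?ax ?ay ?az ?cx ?cy ?cz; ring.
Qed.

(** The two given crossing points u and v are combined so that their parts along a and c add up to
    p; the rest is a multiple of y, while the sum stays in the cone of e and f. *)
Lemma pasch p a c y e f : small g (dist e f) -> cone p a c ->
  cross a y e f -> cross c y e f -> cross p y e f.
Proof.
move=> sm [al [ga [al0 ga0 [px py pz]]]].
move=> [u [[s [t [s0 t0 [ux uy uz]]]] [u1 [u2 [u10 u20 [ux' uy' uz']]]]]].
move=> [v [[s' [t' [s'0 t'0 [vx vy vz]]]] [v1 [v2 [v10 v20 [vx' vy' vz']]]]]].
have at_y (w : pt) (r : R) : 0 <= r -> X w = r * X y -> Y w = r * Y y ->
    Z w = r * Z y -> cone w e f -> cross p y e f.
  by move=> r0 wx wy wz wef; exists w; split=> //; exists 0, r; split=> //;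
    split; rewrite mul0r add0r.
have [s00|s00] := eqVneq s 0.
  apply: (at_y u t) => //; rewrite ?ux ?uy ?uz ?s00 ?mul0r ?add0r //.
  by exists u1, u2.
have [s'00|s'00] := eqVneq s' 0.
  apply: (at_y v t') => //; rewrite ?vx ?vy ?vz ?s'00 ?mul0r ?add0r //.
  by exists v1, v2.
have sp : 0 < s by rewrite lt_neqAle eq_sym s00.
have s'p : 0 < s' by rewrite lt_neqAle eq_sym s'00.
(* Chosen so that m u + n v = p + (m t + n t') y. *)
pose m := al / s; pose n := ga / s'.
have m0 : 0 <= m by rewrite divr_ge0.
have n0 : 0 <= n by rewrite divr_ge0.
have ms : al = m * s by rewrite /m divfK.
have ns : ga = n * s' by rewrite /n divfK.
have E1 : X p + (m * t + n * t') * X y = (m * u1 + n * v1) * X e + (m * u2 + n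
  * v2) * X f.
  rewrite px ms ns; transitivity (m * X u + n * X v); first by rewrite ux vx;
    ring.
  by rewrite ux' vx'; ring.
have E2 : Y p + (m * t + n * t') * Y y = (m * u1 + n * v1) * Y e + (m * u2 + n
  * v2) * Y f.
  rewrite py ms ns; transitivity (m * Y u + n * Y v); first by rewrite uy vy;
    ring.
  by rewrite uy' vy'; ring.
have E3 : Z p + (m * t + n * t') * Z y = (m * u1 + n * v1) * Z e + (m * u2 + n
  * v2) * Z f.
  rewrite pz ms ns; transitivity (m * Z u + n * Z v); first by rewrite uz vz;
    ring.
  by rewrite uz' vz'; ring.
have k10 : 0 <= m * u1 + n * v1 by rewrite addr_ge0 // mulr_ge0.
have k20 : 0 <= m * u2 + n * v2 by rewrite addr_ge0 // mulr_ge0.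
have r0 : 0 <= m * t + n * t' by rewrite addr_ge0 // mulr_ge0.
(* Otherwise m = n = 0, and p would be the zero vector. *)
have wpos : 0 < (m * u1 + n * v1) + (m * u2 + n * v2).
  rewrite lt_neqAle addr_ge0 // andbT eq_sym; apply/eqP => K0.
  have K1 : m * u1 + n * v1 = 0 by lra.
  have K2 : m * u2 + n * v2 = 0 by lra.
  have nz (k1 k2 l1 l2 : R) : 0 <= k1 -> 0 <= k2 -> 0 <= l1 -> 0 <= l2 -> k1 *
    l1 + k2 * l2 = 0 ->
      k1 * l1 = 0 /\ k2 * l2 = 0.
    by move=> k1p k2p l1p l2p; have := mulr_ge0 k1p l1p;
      have := mulr_ge0 k2p l2p; lra.
  have [mu1 nv1] := nz _ _ _ _ m0 n0 u10 v10 K1.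
  have [mu2 nv2] := nz _ _ _ _ m0 n0 u20 v20 K2.
  have mz : m = 0.
    apply/eqP; apply/negPn/negP => mn.
    have u1z : u1 = 0 by apply: (mulfI mn); rewrite mu1 mulr0.
    have u2z : u2 = 0 by apply: (mulfI mn); rewrite mu2 mulr0.
    have := prxx u; rewrite /pr ux' uy' uz' u1z u2z; lra.
  have nz' : n = 0.
    apply/eqP; apply/negPn/negP => nn.
    have v1z : v1 = 0 by apply: (mulfI nn); rewrite nv1 mulr0.
    have v2z : v2 = 0 by apply: (mulfI nn); rewrite nv2 mulr0.
    have := prxx v; rewrite /pr vx' vy' vz' v1z v2z; lra.
  have := prxx p; rewrite /pr px py pz ms ns mz nz'; lra.
have [w [k [k0 hw _]]] := comb_pt sm k10 k20 wpos.
exists w; split; last first.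
  by exists (k * (m * u1 + n * v1)), (k * (m * u2 + n * v2)); split=> //;
    rewrite mulr_ge0 // ltW.
exists k, (k * (m * t + n * t')); split;
  [exact: ltW|by rewrite mulr_ge0 // ltW|].
case: hw => wx wy wz; split.
- transitivity (k * (X p + (m * t + n * t') * X y)); last by ring.
  by rewrite wx E1; ring.
- transitivity (k * (Y p + (m * t + n * t') * Y y)); last by ring.
  by rewrite wy E2; ring.
- transitivity (k * (Z p + (m * t + n * t') * Z y)); last by ring.
  by rewrite wz E3; ring.
Qed.

End Crossing.

(** * Hinges *)

Section Hinge.
Variables (R : realType) (g : geom).
Local Notation ep := (eps g : R).
Local Notation pt := (pt R g).
Local Notation pole := (pole R g).
Implicit Types a c p u v w b y : pt.

Definition lt2pi (r : R) : Prop := g = Sph -> r < pi *+ 2.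

Lemma md_pole (u : pt) (r : R) : X u ^+ 2 + Y u ^+ 2 = sn g r ^+ 2 -> Z u = cs
  g r ->
  md pole u = hsq g r.
Proof.
move=> h hz; rewrite mdE X_pole Y_pole Z_pole hz !sub0r !sqrrN h hsqE //.
Qed.

(** When r + s exceeds pi, the perimeter bound gives t <= 2 pi - (r + s), and [hsq] is symmetric
    about pi on the sphere. *)
Lemma hsq_le_perimeter (r s t : R) : rng g t -> 0 <= r -> 0 <= s ->
  t <= r + s -> lt2pi (r + s + t) -> hsq g t <= hsq g (r + s).
Proof.
move=> ht r0 s0 trs per.
have rs0 : 0 <= r + s by rewrite addr_ge0.
have [rs|rs] := pselect (rng g (r + s)); first by rewrite hsq_le.
have [gS|gS] := SphP g; last by case: rs; split.
have := per gS; rewrite mulr2n => per'.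
have pirs : pi < r + s by rewrite ltNge; apply/negP => le; apply: rs.
have rr : rng g (pi *+ 2 - (r + s)) by rewrite mulr2n; split=> [|_];
  have := ht.1; lra.
by rewrite -(hsq_2piB (r + s)) // (hsq_le ht rr) mulr2n; lra.
Qed.

Lemma hsq_norm (r : R) : hsq g `|r| = hsq g r.
Proof. by have [r0|r0] := ger0P r; rewrite ?hsqN. Qed.

Lemma apex a c (l1 l2 k : R) : 0 < dist a c -> small g (dist a c) ->
  0 <= l1 -> 0 <= l2 -> l1 <= l2 + dist a c -> l2 <= l1 + dist a c ->
  dist a c <= l1 + l2 -> lt2pi (l1 + l2 + dist a c) ->
  exists b, [/\ dist b a = l1, dist b c = l2 & k * det a c b <= 0].
Proof.
move=> D0 smD l10 l20 h1 h2 h3 per.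
have [f [fi [fI fa Yc Xc]]] := normalize a c.
have [fK fVK fmd _ _ [j [j1 fdet]]] := fI.
have [Zc Rc] := polar (f c).
have DE : dist pole (f c) = dist a c by rewrite -fa (isom_dist _ _ fI).
rewrite DE in Zc Rc.
have rngl (l l' : R) : 0 <= l -> l <= l' + dist a c -> lt2pi (l + l' + dist a
  c) -> rng g l.
  by move=> l0 ll' p; split=> // /p; rewrite mulr2n; lra.
have rl1 : rng g l1 by apply: rngl h1 per.
have rl2 : rng g l2 by apply: rngl h2 _ => //; rewrite (addrC l2).
set D := dist a c in D0 smD h1 h2 h3 per DE Zc Rc rngl *.
have sD : 0 < sn g D by exact: sn_gt0.
have s1 : 0 <= sn g l1 by exact: sn_ge0.
have XcE : X (f c) = sn g D.
  by apply: (pexpIrn (n := 2)) => //;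
    rewrite ?nnegrE ?ltW // -Rc Yc expr0n addr0.
have le1 : hsq g l2 <= hsq g (l1 + D).
  apply: hsq_le_perimeter => //; first exact: ltW.
  by move=> /per; rewrite addrAC.
have le2 : hsq g (l1 - D) <= hsq g l2.
  rewrite -hsq_norm hsq_le //; first by rewrite ler_norml; apply/andP; split;
    lra.
  split=> // gS; have [_ /(_ gS) l1pi] := rl1; have [_ /(_ gS)] := dist_rng a c.
  by rewrite ler_norml -/D => Dpi; apply/andP; split; lra.
have hB : hsq g (l1 - D) + sn g l1 * sn g D = hsq g (l1 + D) - sn g l1 * sn g D.
  by rewrite hsqB hsqD; lra.
(* The first coordinate of b, solved from [md_polar] with c on the x-axis. *)
pose x := (hsq g (l1 + D) - sn g l1 * sn g D - hsq g l2) / sn g D.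
have xD : x * sn g D = hsq g (l1 + D) - sn g l1 * sn g D - hsq g l2.
  by rewrite /x divfK // lt0r_neq0.
have x1 : - sn g l1 <= x by rewrite -(ler_pM2r sD) xD; lra.
have x2 : x <= sn g l1 by rewrite -(ler_pM2r sD) xD; lra.
have x3 : x ^+ 2 <= sn g l1 ^+ 2.
  by rewrite -[x ^+ 2]real_normK ?num_real // ler_pXn2r ?nnegrE // ler_norml x1.
pose q := Num.sqrt (sn g l1 ^+ 2 - x ^+ 2).
have q0 : 0 <= q by exact: sqrtr_ge0.
have q2 : q ^+ 2 = sn g l1 ^+ 2 - x ^+ 2 by rewrite sqr_sqrtr //; lra.
(* The sign of z selects the side of the line a c; [j] corrects for the orientation of the
   normalising isometry. *)
have [z [z2 zk]] : exists z : R, z ^+ 2 = q ^+ 2 /\ j * k * z <= 0.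
  have [jk|jk] := lerP 0 (j * k).
    by exists (- q); rewrite sqrrN mulrN oppr_le0 mulr_ge0.
  by exists q; rewrite mulr_le0_ge0 // ltW.
have [||b [Xb Yb Zb]] := @mk_pt R g x z (cs g l1).
- rewrite z2 q2 cs2; ring.
- exact: cs_gt0.
have bD : dist pole b = l1.
  by apply: dist_eq => //; apply: md_pole => //; rewrite Xb Yb z2 q2; ring.
exists (fi b); split.
- by rewrite -(isom_dist _ _ fI) fVK fa dist_sym.
- apply: dist_eq => //; rewrite -fmd fVK md_polar bD DE Xb Yc XcE xD; ring.
have -> : det a c (fi b) = j * det (f a) (f c) b.
  by rewrite -[b in RHS]fVK fdet mulrA -expr2 j1 mul1r.
rewrite mulrA (mulrC k) fa /det X_pole Y_pole Z_pole Yc Yb XcE.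
have -> : j * k * (0 * (0 * Z b - Z (f c) * z) - 0 * (sn g D * Z b - Z (f c) *
  X b)
    + 1 * (sn g D * z - 0 * X b)) = sn g D * (j * k * z) by ring.
by rewrite pmulr_rle0.
Qed.

(* The hinge [b - a - y] can be straightened at [a] without lengthening
   [b c]. *)
Definition reflex a c b y : Prop := exists b',
  [/\ dist b' a = dist b a, dist b' c <= dist b c &
      dist b' y = dist b a + dist a y].

Lemma isom_reflex f fi a c b y : isom f fi ->
  reflex (f a) (f c) (f b) (f y) -> reflex a c b y.
Proof.
move=> fI [b' []]; have [_ fVK _ _ _ _] := fI;
  rewrite -{1 2 3}[b']fVK !(isom_dist _ _ fI).
by exists (fi b').
Qed.

(** With c on the positive x-axis, the last hypothesis says that the cosines of the angles from c to
    b and from c to y have a nonpositive sum. The point opposite to y at the distance of b then has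
    an x-coordinate at least that of b, so it is no farther from c. *)
Lemma reflex_pole c b y : Y c = 0 -> 0 <= X c ->
  lt2pi (dist b pole + dist pole y + dist y c + dist b c) ->
  (pole <> y ->
     (sn g (dist pole b) * X y + sn g (dist pole y) * X b) * X c <= 0) ->
  reflex pole c b y.
Proof.
move=> Yc Xc per cond.
have [py|/[dup] py /cond {}cond] := pselect (pole = y).
  by exists b; split; rewrite -?py ?distxx ?addr0.
rewrite (dist_sym b) in per.
set l := dist pole b in per cond *; set r := dist pole y in per cond *.
have r0 : 0 < r by exact: dist_gt0.
have smr : small g r.
  move=> gS; have := per gS; rewrite mulr2n.
  have := dist_triangle b pole y; have := dist_triangle c b y.
  by rewrite (dist_sym c y) -/l -/r; lra.
have sr : 0 < sn g r by exact: sn_gt0.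
have rl : rng g l by exact: dist_rng.
have [Zy Ry] := polar y; have [Zb Rb] := polar b.
rewrite -/r -/l in Zy Ry Zb Rb.
pose x1 := - (sn g l * X y / sn g r); pose y1 := - (sn g l * Y y / sn g r).
have xy1 : x1 ^+ 2 + y1 ^+ 2 = sn g l ^+ 2.
  rewrite /x1 /y1 !sqrrN !exprMn -mulrDl -mulrDr Ry exprVn mulfK //.
  by rewrite expf_neq0 // lt0r_neq0.
have [||b' [Xb' Yb' Zb']] := @mk_pt R g x1 y1 (cs g l).
- by rewrite xy1 cs2.
- exact: cs_gt0.
have lb' : dist pole b' = l.
  by apply: dist_eq => //; apply: md_pole => //; rewrite Xb' Yb'.
have le_c : dist b' c <= dist b c.
  rewrite le_dist (md_polar b' c) (md_polar b c) lb' -/l Yc !mulr0 !addr0 Xb'.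
  rewrite lerD2l lerN2 /x1 -(ler_pM2r sr).
  have -> : - (sn g l * X y / sn g r) * X c * sn g r =
    - (sn g l * X y * X c) * (sn g r / sn g r) by ring.
  by rewrite divff ?lt0r_neq0 // mulr1; lra.
have mdy : md b' y = hsq g (l + r).
  rewrite md_polar lb' -/r Xb' Yb' /x1 /y1.
  have -> : - (sn g l * X y / sn g r) * X y + - (sn g l * Y y / sn g r) * Y y =
    - (sn g l * ((X y ^+ 2 + Y y ^+ 2) / sn g r)) by ring.
  by rewrite Ry expr2 mulfK ?lt0r_neq0 //; ring.
exists b'; rewrite (dist_sym b') (dist_sym b) -/l; split=> //.
have lr0 : 0 <= l + r by rewrite addr_ge0 ?dist_ge0.
have [rng_lr|nrng] := pselect (rng g (l + r)); first exact: dist_eq.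
have [gS|gS] := SphP g; last by case: nrng; split.
(* Now b' and y would be at distance 2 pi - (l + r), and the path through c would make the perimeter
   at least 2 pi. *)
have pilr : pi < l + r by rewrite ltNge; apply/negP => le; apply: nrng.
have := per gS; rewrite mulr2n => per'.
have : dist b' y = pi *+ 2 - (l + r).
  apply: dist_eq; last by rewrite hsq_2piB.
  have [_ /(_ gS) lpi] := rl; have := smr gS.
  have := dist_ge0 y c; have := dist_ge0 b c.
  by rewrite mulr2n; split=> [|_]; lra.
have := dist_triangle c b' y; rewrite (dist_sym c y) mulr2n => t1 t2.
by exfalso; clear gS; lra.
Qed.

(** For two vectors of the upper half-plane with angles alpha and beta: if sin (alpha + beta) < 0
    then alpha + beta > pi, so cos alpha + cos beta <= 0. *)
Lemma obtuse_hinge (x y u v r s : R) : 0 <= y -> 0 <= v -> 0 <= r -> 0 <= s ->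
  x ^+ 2 + y ^+ 2 = r ^+ 2 -> u ^+ 2 + v ^+ 2 = s ^+ 2 ->
  x * v + u * y < 0 -> s * x + r * u <= 0.
Proof.
move=> y0 v0 r0 s0.
wlog xu : x y u v r s y0 v0 r0 s0 / x <= u.
  move=> H hr hs neg; have [xu|ux] := lerP x u; first exact: (H x y u v r s).
  by rewrite addrC; apply: (H u v x y s r) => //; [exact: ltW|rewrite addrC].
move=> hr hs neg.
have [u0|u0] := lerP u 0.
  have := mulr_ge0 s0 (_ : 0 <= - x); have := mulr_ge0 r0 (_ : 0 <= - u).
  by rewrite !oppr_ge0 => /(_ u0) A /(_ (le_trans xu u0)) B; lra.
have x0 : x < 0.
  rewrite ltNge; apply/negP => x0; have := mulr_ge0 x0 v0.
  have := mulr_ge0 (ltW u0) y0; lra.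
suff : r * u <= s * - x by lra.
rewrite -(@ler_pXn2r _ 2) ?nnegrE ?mulr_ge0 //; [|exact: ltW|lra].
have yv : u * y <= - x * v by lra.
have : (u * y) ^+ 2 <= (- x * v) ^+ 2.
  by rewrite ler_pXn2r ?nnegrE ?mulr_ge0 // ?ltW //; lra.
by rewrite !exprMn -hr -hs sqrrN; lra.
Qed.

(** By [reflex_pole] the cosines of the angles at a have a positive sum. So the angles add up to
    less than pi or stay on one side of the line b a, y is not opposite to c, and a degenerate b
    lies on the ray from a through c. *)
Lemma not_reflex a c b y (k : R) : k ^+ 2 = 1 ->
  0 < dist a c -> small g (dist a c) ->
  lt2pi (dist b a + dist a y + dist y c + dist b c) ->
  0 <= k * det a c y -> k * det a c b <= 0 -> ~ reflex a c b y ->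
  [/\ 0 <= k * det a b y, ~ cone a y c &
      det a c b = 0 -> cone b a c \/ dist a b = dist a c + dist c b].
Proof.
move=> k1 D0 smD per dy db nr.
have [f [fi [fI fa Yc Xc]]] := normalize a c.
have [_ _ _ _ _ [j [j1 fdet]]] := fI.
have detE u v w : det u v w = j * det (f u) (f v) (f w).
  by rewrite fdet mulrA -expr2 j1 mul1r.
rewrite (detE a c y) mulrA fa in dy; rewrite (detE a c b) mulrA fa in db.
rewrite (detE a b y) (detE a c b) mulrA fa.
have jk1 : (k * j) ^+ 2 = 1 by rewrite exprMn k1 j1 mulr1.
move: per nr D0 smD.
rewrite -(isom_dist b a fI) -(isom_dist a y fI) -(isom_dist y c fI) -(isom_dist
  b c fI).
rewrite -(isom_dist a c fI) -(isom_dist a b fI) -(isom_dist c b fI).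
rewrite -(propext (isom_cone a y c fI)) -(propext (isom_cone b a c fI)) fa.
move=> per nr D0 smD.
have {}nr : ~ reflex pole (f c) (f b) (f y).
  by move=> H; apply: nr; apply: (isom_reflex fI); rewrite fa.
move: (k * j) jk1 dy db => i i1.
move: (f c) (f b) (f y) Yc Xc per nr D0 smD => {a c b y fa fdet detE fI f fi
  k1}.
move=> c b y Yc Xc per nr D0 smD.
have sD : 0 < sn g (dist pole c) by exact: sn_gt0.
have [Zc Rc] := polar c; have [Zy Ry] := polar y; have [Zb Rb] := polar b.
have XcE : X c = sn g (dist pole c).
  by apply: (pexpIrn (n := 2)) => //;
    rewrite ?nnegrE ?ltW // -Rc Yc expr0n addr0.
have detc u : det pole c u = X c * Y u.
  by rewrite /det X_pole Y_pole Z_pole Yc; ring.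
rewrite !detc !(mulrCA i) XcE pmulr_rge0 // pmulr_rle0 // => dy db.
have s1 := sn_dist_ge0 pole b; have s2 := sn_dist_ge0 pole y.
have {}nr : 0 < sn g (dist pole b) * X y + sn g (dist pole y) * X b.
  rewrite ltNge; apply/negP => le; apply: nr.
  by apply: reflex_pole => // _; apply: mulr_le0_ge0.
have sq (u : R) : (i * u) ^+ 2 = u ^+ 2 by rewrite exprMn i1 mul1r.
have abs_le (x z r : R) : 0 <= r -> x ^+ 2 + z ^+ 2 = r ^+ 2 -> - r <= x /\ x
  <= r.
  move=> r0 h; apply/andP; rewrite -ler_norml -(@ler_pXn2r _ 2) ?nnegrE //.
  by rewrite real_normK ?num_real // -h lerDl sqr_ge0.
have [lb ub] := abs_le _ _ _ s1 Rb; have [ly uy] := abs_le _ _ _ s2 Ry.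
split.
- rewrite leNgt; apply/negP => neg.
  have : sn g (dist pole b) * X y + sn g (dist pole y) * X b <= 0; last by lra.
  apply: (@obtuse_hinge (X y) (i * Y y) (X b) (- (i * Y b))) => //.
  + by rewrite oppr_ge0.
  + by rewrite sq.
  + by rewrite sqrrN sq.
  move: neg; rewrite /det X_pole Y_pole Z_pole; lra.
- move=> [s [t [s0 t0 [hx hy hz]]]]; rewrite X_pole in hx; rewrite Y_pole in hy.
  rewrite Z_pole in hz.
  have [s00|s00] := eqVneq s 0.
    move: hx hz; rewrite s00 XcE !mul0r !add0r => /esym/eqP.
    by rewrite mulf_eq0 (gt_eqF sD) orbF => /eqP ->; rewrite mul0r; lra.
  have sp : 0 < s by rewrite lt_neqAle eq_sym s00.
  have Yy0 : Y y = 0.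
    by apply: (mulfI s00); rewrite mulr0 [RHS]hy Yc mulr0 addr0.
  have Xy0 : X y <= 0.
    rewrite -(pmulr_rle0 _ sp); have : 0 <= t * X c by rewrite mulr_ge0.
    by lra.
  have : sn g (dist pole y) = - X y.
    apply: (pexpIrn (n := 2)) => //; rewrite ?nnegrE ?oppr_ge0 //.
    by rewrite sqrrN -Ry Yy0 expr0n addr0.
  move=> E; rewrite E in nr.
  have : X y * (sn g (dist pole b) - X b) <= 0 by rewrite mulr_le0_ge0 //
    subr_ge0.
  by lra.
move=> /eqP; rewrite mulf_eq0; have /negPf -> : j != 0.
  by apply/eqP => j0; move/eqP: j1; rewrite j0 expr0n /= eq_sym oner_eq0.
rewrite mulf_eq0 (gt_eqF sD) => /eqP Yb0.
have Xb : X b = sn g (dist pole b).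
  have /eqP : X b ^+ 2 = sn g (dist pole b) ^+ 2 by rewrite -Rb Yb0 expr0n
    addr0.
  rewrite eqf_sqr => /orP[/eqP //|/eqP E]; exfalso; move: nr; rewrite E.
  have : 0 <= sn g (dist pole b) * (sn g (dist pole y) - X y) by rewrite
    mulr_ge0 // subr_ge0.
  by lra.
have [bD|Db] := lerP (dist pole b) (dist pole c).
  left; exists (sn g (dist pole c - dist pole b) / sn g (dist pole c)).
  exists (sn g (dist pole b) / sn g (dist pole c)); split.
  - apply: divr_ge0 => //; last exact: ltW.
    apply: sn_ge0; split=> [|gS]; first by rewrite subr_ge0.
    by have [_ /(_ gS)] := dist_rng pole c; have := dist_ge0 pole b; lra.
  - by apply: divr_ge0 => //; exact: ltW.
  split; rewrite ?X_pole ?Y_pole ?Z_pole ?Xb ?Yb0 ?Zb ?Yc ?XcE ?Zc.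
  - by rewrite mulr0 add0r divfK // lt0r_neq0.
  - by rewrite !mulr0 addr0.
  have sD0 : sn g (dist pole c) != 0 by rewrite lt0r_neq0.
  rewrite snD csN snN; move: (cs g (dist pole b)) (cs g (dist pole c)) (sn g _)
    (sn g _) sD0.
  by move=> ? ? ? ? ?; field.
right.
have : dist c b = dist pole b - dist pole c; last by lra.
apply: dist_eq.
  split=> [|gS]; first by rewrite subr_ge0 ltW.
  by have [_ /(_ gS)] := dist_rng pole b; lra.
by rewrite md_polar Xb XcE Yc hsqB hsqD; lra.
Qed.

(** When a = c the direction towards c is void, so every hinge can be straightened. *)
Lemma reflex_eq c b y : lt2pi (dist b c + dist c y + dist y c + dist b c) ->
  reflex c c b y.
Proof.
move=> per; have [f [fi [fI fc]]] := to_pole c.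
apply: (isom_reflex fI); rewrite fc; apply: reflex_pole;
  rewrite ?X_pole ?Y_pole //.
  by rewrite -fc !(isom_dist _ _ fI).
by rewrite mulr0.
Qed.

Lemma det_combr u v p a c (s t : R) : comb p s a t c ->
  det u v p = s * det u v a + t * det u v c.
Proof. by case=> hx hy hz; rewrite /det hx hy hz; ring. Qed.

(** The linear relation of four vectors of R^3. When the four determinants have the same sign, both
    sides point to the crossing of [a, c] and [b, y]. *)
Lemma cramer a b c y :
  [/\ det b c y * X a + det a b y * X c = det a c y * X b + det a b c * X y,
      det b c y * Y a + det a b y * Y c = det a c y * Y b + det a b c * Y y &
      det b c y * Z a + det a b y * Z c = det a c y * Z b + det a b c * Z y].
Proof. by rewrite /det; split; ring. Qed.

Lemma det_swap23 u v w : det u w v = - det u v w.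
Proof. by rewrite /det; ring. Qed.

Lemma det_swap12 u v w : det v u w = - det u v w.
Proof. by rewrite /det; ring. Qed.

Lemma comb_neq0 p a c (s t : R) : comb p s a t c -> (s == 0) && (t == 0) =
  false.
Proof.
move=> h; apply/negP => /andP[/eqP s0 /eqP t0].
by have := comb_norm h; rewrite s0 t0; lra.
Qed.

Lemma comb_rayl p a c u v (s s1 t1 : R) : 0 <= s -> 0 <= s1 -> 0 <= t1 ->
  comb p s a 0 c -> comb p s1 u t1 v -> cone a u v.
Proof.
move=> s0 s10 t10 h [hx hy hz].
have sn0 : s != 0 by have := comb_neq0 h; rewrite eqxx andbT => ->.
case: h => ax ay az; exists (s1 / s), (t1 / s); split; try exact: divr_ge0.
have div_s (x xu xv : R) : s * x = s1 * xu + t1 * xv -> x = s1 / s * xu + t1 /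
  s * xv.
  by move=> E; apply: (mulfI sn0); rewrite E; field.
by split; apply: div_s; rewrite -?hx -?hy -?hz ?ax ?ay ?az; ring.
Qed.

(** Non-reflexivity is assumed only at y1 and y2, the vertices next to a and c in the application.
    The crossings of diagonals carry the signs of [det a b y1] and [det b c y2] over to y, and
    [cramer] yields the common point. *)
Lemma convex_apex_cross a c b y1 y2 y (k : R) : k ^+ 2 = 1 ->
  0 < dist a c -> small g (dist a c) -> small g (dist b y) ->
  lt2pi (dist b a + dist a y1 + dist y1 c + dist b c) ->
  lt2pi (dist b a + dist a y2 + dist y2 c + dist b c) ->
  0 <= k * det a c y1 -> 0 <= k * det a c y2 -> 0 <= k * det a c y ->
  k * det a c b <= 0 ->
  ~ reflex a c b y1 -> ~ reflex c a b y2 ->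
  cross a y y1 c -> cross a y2 y c -> cross a c b y.
Proof.
move=> k1 D0 smD smby per1 per2 dy1 dy2 dy db nr1 nr2.
have [A1 A2 A3] := not_reflex k1 D0 smD per1 dy1 db nr1.
have [||||||C1 C2 C3] := @not_reflex c a b y2 (- k) _ _ _ _ _ _ nr2.
- by rewrite sqrrN.
- by rewrite dist_sym.
- by rewrite dist_sym.
- move=> /per2; rewrite (dist_sym c) (dist_sym y2 a); lra.
- by rewrite det_swap12 mulrNN.
- by rewrite det_swap12 mulrNN.
have dabc : 0 <= k * det a b c by rewrite det_swap23 mulrN oppr_ge0.
move=> [p [[s [t [s0 t0 h]]] [s1 [t1 [s10 t10 h1]]]]].
move=> [q [[s' [t' [s'0 t'0 h']]] [s1' [t1' [s1'0 t1'0 h1']]]]].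
have ga : 0 <= k * det a b y.
  (* If t = 0 then p = a would lie on [y1, c], which non-reflexivity at a excludes. *)
  have [t00|t00] := eqVneq t 0.
    by case: A2; rewrite t00 in h; apply: comb_rayl s10 t10 h h1.
  have tp : 0 < t by rewrite lt_neqAle eq_sym t00.
  rewrite -(pmulr_rge0 _ tp); have := det_combr a b h;
    rewrite (det_combr a b h1).
  have -> : det a b a = 0 by rewrite /det; ring.
  have := mulr_ge0 s10 A1; have := mulr_ge0 t10 dabc => h2 h3 h4.
  rewrite mulrCA; have -> : t * det a b y = s1 * det a b y1 + t1 * det a b c by
    lra.
  lra.
have al : 0 <= k * det b c y.
  have [s00|s00] := eqVneq s1' 0.
    case: C2; rewrite s00 in h1'.
    have h2 : comb q t1' c 0 y by case: h1' => ? ? ?; split; lra.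
    by apply/cone_sym; apply: comb_rayl t1'0 s'0 t'0 h2 h'.
  have sp : 0 < s1' by rewrite lt_neqAle eq_sym s00.
  rewrite -(pmulr_rge0 _ sp); have := det_combr b c h';
    rewrite (det_combr b c h1').
  have -> : det b c c = 0 by rewrite /det; ring.
  have dbca : det b c a = det a b c by rewrite /det; ring.
  have C1' : 0 <= k * det b c y2 by move: C1; rewrite det_swap12; lra.
  rewrite dbca; have := mulr_ge0 s'0 dabc; have := mulr_ge0 t'0 C1' => h2 h3 h4.
  rewrite mulrCA; have -> : s1' * det b c y = s' * det a b c + t' * det b c y2
    by lra.
  lra.
(* Both weights vanish, so b is on the line a c. If it were off the segment, c would lie between a
   and b, and a between c and b. *)
have [bd0|bd0] := eqVneq (k * det a c y + k * det a b c) 0.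
  have k0 : k != 0 by apply/eqP => k0; move: k1; rewrite k0 expr0n /= => /eqP;
    rewrite eq_sym oner_eq0.
  have db0 : det a c b = 0.
    apply: (mulfI k0); rewrite mulr0; have E := det_swap23 a c b.
    by rewrite E in bd0; lra.
  case: (A3 db0) => [bac|e1]; first by exists b; split=> //; exact: cone_l.
  have cb0 : det c a b = 0 by rewrite det_swap12 db0 oppr0.
  case: (C3 cb0) => [/cone_sym bac|e2]; first by exists b; split=> //;
    exact: cone_l.
  by exfalso; rewrite (dist_sym c a) in e2; lra.
have bd : 0 < k * det a c y + k * det a b c by rewrite lt_neqAle eq_sym bd0
  addr_ge0.
have [z [r [r0 [zx zy zz] _]]] := comb_pt smby dy dabc bd.
exists z; split; last first.
  by exists (r * (k * det a c y)), (r * (k * det a b c)); split=> //;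
    rewrite mulr_ge0 // ltW.
exists (r * (k * det b c y)), (r * (k * det a b y)); split;
  try by rewrite mulr_ge0 // ltW.
have [cx cy cz] := cramer a b c y; split.
- rewrite zx; transitivity (r * k * (det a c y * X b + det a b c * X y));
    first by ring.
  by rewrite -cx; ring.
- rewrite zy; transitivity (r * k * (det a c y * Y b + det a b c * Y y));
    first by ring.
  by rewrite -cy; ring.
- rewrite zz; transitivity (r * k * (det a c y * Z b + det a b c * Z y));
    first by ring.
  by rewrite -cz; ring.
Qed.

(** The bound covers all configurations with a longer base and a nearer qy. Those coming from the
    four-point condition are compared this way; taking qa = a, qc = c, qy = y shows that b' is a
    maximiser. *)
Definition farthest a c y (l1 l2 : R) (b' : pt) : Prop :=
  [/\ dist b' a <= l1, dist b' c <= l2 &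
    forall qa qb qc qy : pt, dist a c <= dist qa qc ->
      dist qb qa <= l1 -> dist qb qc <= l2 ->
      dist qy qa <= dist y a -> dist qy qc <= dist y c ->
      dist qb qy <= dist b' y].

Lemma farthest_sym a c y l1 l2 b' :
  farthest a c y l1 l2 b' -> farthest c a y l2 l1 b'.
Proof.
case=> h1 h2 h3; split=> // qa qb qc qy h; rewrite dist_sym (dist_sym qa) in h.
by move=> *; apply: (h3 qc qb qa).
Qed.

(** The straightened hinge attains the bound that the triangle inequality through qa imposes. *)
Lemma reflex_farthest a c b y : reflex a c b y ->
  exists b', farthest a c y (dist b a) (dist b c) b'.
Proof.
move=> [b' [h1 h2 h3]]; exists b'; split=> //; first by rewrite h1.
move=> qa qb qc qy _ ba _ ya _; apply: (le_trans (dist_triangle qa qb qy)).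
by rewrite h3 (dist_sym qa) (dist_sym a) lerD.
Qed.

(** A hinge that is reflex at a or at c is straightened. Otherwise [b, y] crosses [a, c], and b
    itself is extremal by [crossing]. *)
Lemma farthest_exists a c b y (k : R) : k ^+ 2 = 1 ->
  0 < dist a c -> small g (dist a c) -> small g (dist b y) ->
  lt2pi (dist b a + dist a y + dist y c + dist b c) ->
  0 <= k * det a c y -> k * det a c b <= 0 ->
  exists b', farthest a c y (dist b a) (dist b c) b'.
Proof.
move=> k1 D0 smD smby per dy db.
have [/reflex_farthest //|nr1] := pselect (reflex a c b y).
have [/reflex_farthest [b' /farthest_sym]|nr2] := pselect (reflex c a b y).
  by exists b'.
have [||p [pac pby]] := convex_apex_cross k1 D0 smD smby per per dy dy dy db
  nr1 nr2.
- by exists y; split; [exact: cone_r|exact: cone_l].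
- by exists y; split; [exact: cone_r|exact: cone_l].
by exists b; split=> // qa qb qc qy h1 h2 h3 h4 h5;
  exact: crossing pac pby h1 h2 h3 h4 h5.
Qed.

End Hinge.

(** * Convex comparison polygons *)

Section Polygons.
Variables (R : realType) (g : geom).
Local Notation pt := (pt R g).
Local Notation lt2pi := (lt2pi g).
Implicit Types (D : nat -> nat -> R) (h : nat -> pt) (i j k l m : nat).

Definition per m D : R := \sum_(0 <= t < m) D t t.+1 + D m 0%N.

Definition quad D i j k l : Prop := exists qi qj qk ql : pt,
  [/\ dist qi qj <= D i j, dist qj qk <= D j k, dist qk ql <= D k l &
      dist ql qi <= D l i] /\ (D i k <= dist qi qk /\ D j l <= dist qj ql).

(* Distances between the vertices 0, ..., m of a closed polygon, of which only
   the quadruples in cyclic order are compared with the model space. *)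
Record cyc m D : Prop := Cyc {
  cyc_self : forall i, (i <= m)%N -> D i i = 0;
  cyc_sym : forall i j, (i <= m)%N -> (j <= m)%N -> D i j = D j i;
  cyc_tri : forall i j k, (i <= m)%N -> (j <= m)%N -> (k <= m)%N ->
    D i k <= D i j + D j k;
  cyc_per : lt2pi (per m D);
  cyc_quad : forall i j k l, (i < j)%N -> (j < k)%N -> (k < l)%N -> (l <= m)%N
    ->
    quad D i j k l }.

(** Convexity is stated as the crossing of diagonals, which still makes sense for degenerate
    polygons. *)
Record realizes m D h : Prop := Realizes {
  real_side : forall i, (i < m)%N -> dist (h i) (h i.+1) = D i i.+1;
  real_last : dist (h m) (h 0%N) = D m 0%N;
  real_ge : forall i j, (i <= m)%N -> (j <= m)%N -> D i j <= dist (h i) (h j);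
  real_cross : forall i j k l, (i < j)%N -> (j < k)%N -> (k < l)%N -> (l <=
    m)%N ->
    cross (h i) (h k) (h j) (h l) }.

Lemma cyc_ge0 m D i j : cyc m D -> (i <= m)%N -> (j <= m)%N -> 0 <= D i j.
Proof.
move=> cD im jm; have := cyc_tri cD im jm im.
by rewrite (cyc_self cD) // (cyc_sym cD jm) //; lra.
Qed.

Lemma polygon_path_le m D i j : (forall i, (i <= m)%N -> D i i = 0) ->
  (forall i j k, (i <= m)%N -> (j <= m)%N -> (k <= m)%N -> D i k <= D i j + D j
    k) ->
  (i <= j)%N -> (j <= m)%N -> D i j <= \sum_(i <= t < j) D t t.+1.
Proof.
move=> self tri; elim: j => [|j IH] ij jm.
  have -> : i = 0%N by lia.
  by rewrite self // big_geq.
have [E|ij'] := eqVneq i j.+1; first by rewrite -E self ?big_geq //; lia.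
have ij1 : (i <= j)%N by lia.
rewrite big_nat_recr //=; apply: (@le_trans _ _ (D i j + D j j.+1)).
  by apply: tri; lia.
by rewrite lerD2r; apply: IH => //; lia.
Qed.

Lemma realizes_path m D h i j : realizes m D h -> (i <= j)%N -> (j <= m)%N ->
  dist (h i) (h j) <= \sum_(i <= t < j) D t t.+1.
Proof.
move=> rh ij jm.
have := @polygon_path_le m (fun i j => dist (h i) (h j)) i j.
move=> /(_ (fun i _ => distxx (h i)) (fun i j k _ _ _ => dist_triangle (h j) (h
  i) (h k)) ij jm) /le_trans.
apply; rewrite le_eqVlt; apply/orP; left; apply/eqP; apply: eq_big_nat => t tj.
by apply: (real_side rh); lia.
Qed.

Lemma big_split3 (F : nat -> R) i j m : (i <= j)%N -> (j <= m)%N ->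
  \sum_(0 <= t < m) F t =
  \sum_(0 <= t < i) F t + \sum_(i <= t < j) F t + \sum_(j <= t < m) F t.
Proof.
move=> ij jm; have im : (i <= m)%N by lia.
by rewrite (@big_cat_nat _ _ _ i 0 m) //= (@big_cat_nat _ _ _ j i m) //= addrA.
Qed.

(** Two vertices cut the boundary into two chains, each at least as long as their distance, so twice
    that distance is below 2 pi. *)
Lemma realizes_small m D h i j : realizes m D h -> lt2pi (per m D) ->
  (i <= m)%N -> (j <= m)%N -> small g (dist (h i) (h j)).
Proof.
move=> rh hp.
wlog ij : i j / (i <= j)%N.
  move=> H im jm; have [ij|ji] := leqP i j; first exact: H.
  by rewrite dist_sym; apply: H => //; lia.
move=> im jm gS; have := hp gS; rewrite /per mulr2n (@big_split3 _ i j m) //.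
have h1 := realizes_path rh ij jm.
have h2 := realizes_path rh (leq0n i) im.
have h3 := realizes_path rh jm (leqnn m).
have := dist_triangle (h 0%N) (h i) (h j).
have := dist_triangle (h m) (h 0%N) (h j).
rewrite (dist_sym (h i) (h 0%N)) (dist_sym (h 0%N) (h m)) (dist_sym (h m) (h
  j)).
rewrite (real_last rh) => h4 h5; clear gS; lra.
Qed.

Lemma cyc_restrict m D : cyc m.+1 D -> (0 < m)%N -> cyc m D.
Proof.
move=> cD m0; split.
- by move=> i im; apply: (cyc_self cD); lia.
- by move=> i j im jm; apply: (cyc_sym cD); lia.
- by move=> i j k im jm km; apply: (cyc_tri cD); lia.
- move=> /(cyc_per cD); rewrite /per big_nat_recr //=; apply: le_lt_trans.
  by rewrite -addrA lerD2l; apply: (cyc_tri cD); lia.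
by move=> i j k l ij jk kl lm; apply: (cyc_quad cD); lia.
Qed.

Definition extend m (h : nat -> pt) (b : pt) i : pt := if i == m then b else h
  i.

Lemma extendE m h b i : (i < m)%N -> extend m h b i = h i.
Proof. by rewrite /extend; case: eqP => [->|//]; rewrite ltnn. Qed.

Lemma extend_last m h b : extend m h b m = b.
Proof. by rewrite /extend eqxx. Qed.

(** The quadruple 0, j, m, m.+1 supplies a configuration to which the bound applies: its base is at
    least [h 0, h m] and its point for j is no farther than h j. *)
Lemma quad_apex m D h (b q : pt) j : cyc m.+1 D -> realizes m D h -> (0 < j)%N
  -> (j < m)%N ->
  (forall qa qb qc qy : pt, dist (h 0%N) (h m) <= dist qa qc ->
      dist qb qa <= D m.+1 0%N -> dist qb qc <= D m m.+1 ->
      dist qy qa <= dist (h j) (h 0%N) -> dist qy qc <= dist (h j) (h m) ->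
      dist qb qy <= dist b q) ->
  D m.+1 j <= dist b q.
Proof.
move=> cD rh j0 jm far.
have [q0 [qj [qm [qN [[e1 e2 e3 e4] [e5 e6]]]]]] := cyc_quad cD j0 jm (ltnSn m)
  (leqnn _).
rewrite (cyc_sym cD) //; last by lia.
apply: (le_trans e6); rewrite dist_sym; apply: (far q0 qN qm qj) => //.
- by rewrite dist_sym (real_last rh) (cyc_sym cD) //; lia.
- by rewrite dist_sym.
- by rewrite dist_sym; apply: (le_trans e1); rewrite dist_sym;
    apply: (real_ge rh); lia.
- by apply: (le_trans e2); apply: (real_ge rh); lia.
Qed.

Lemma realizes_extend m D h b : (0 < m)%N -> cyc m.+1 D -> realizes m D h ->
  dist b (h 0%N) = D m.+1 0%N -> dist b (h m) = D m m.+1 ->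
  (forall j, (0 < j)%N -> (j < m)%N -> cross (h 0%N) (h m) b (h j)) ->
  realizes m.+1 D (extend m.+1 h b).
Proof.
move=> m0 cD rh b0 bm crs; have cD' := cyc_restrict cD m0.
have last_ge j : (j <= m)%N -> D m.+1 j <= dist b (h j).
  move=> jm; have [->|j0] := eqVneq j 0%N; first by rewrite b0.
  have [->|jm'] := eqVneq j m; first by rewrite bm (cyc_sym cD).
  have {}j0 : (0 < j)%N by lia.
  have {}jm : (j < m)%N by lia.
  apply: (quad_apex cD rh j0 jm) => qa qb qc qy;
    have [p [pac pby]] := crs _ j0 jm.
  by rewrite -b0 -bm => h1 h2 h3 h4 h5; exact: crossing pac pby h1 h2 h3 h4 h5.
split.
- move=> i im; rewrite extendE //.
  have [E|im'] := eqVneq i m; first by rewrite E extend_last dist_sym.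
  by rewrite extendE ?(real_side rh) //; lia.
- by rewrite extend_last extendE.
- move=> i j; rewrite /extend.
  case: eqP => [-> _|iN im]; case: eqP => [-> _|jN jm].
  + by rewrite (cyc_self cD) // distxx.
  + by apply: last_ge; lia.
  + by rewrite (cyc_sym cD) // dist_sym; apply: last_ge; lia.
  by apply: (real_ge rh); lia.
move=> i j k l ij jk kl lm.
rewrite (@extendE _ _ _ i) ?(@extendE _ _ _ j) ?(@extendE _ _ _ k); try lia.
have [E|lN] := eqVneq l m.+1; last first.
  rewrite extendE; last by lia.
  by apply: (real_cross rh); lia.
have [j0 jm] : (0 < j)%N /\ (j < m)%N by lia.
(* Since [h 0, h j] and [h m, h j] both meet [h i, h k], so does [p, h j] by [pasch], and [p, h j]
   is a part of [b, h j]. *)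
rewrite E extend_last; have [p [pac pby]] := crs j j0 jm.
have c1 : cross (h 0%N) (h j) (h i) (h k).
  have [i0|i0] := eqVneq i 0%N; last by apply: (real_cross rh); lia.
  by exists (h 0%N); rewrite i0; split; exact: cone_l.
have c2 : cross (h m) (h j) (h i) (h k).
  have [km|km] := eqVneq k m.
    by exists (h m); rewrite km; split; [exact: cone_l|exact: cone_r].
  have := real_cross rh ij jk (_ : k < m)%N (leqnn m).
  by move=> /(_ ltac:(lia)) /cross_sym /cross_flip.
have sm : small g (dist (h i) (h k)).
  by apply: (realizes_small rh (cyc_per cD')); lia.
have [z [z1 z2]] := pasch sm pac c1 c2.
exists z; split=> //; apply/cone_sym; apply: cone_trans z1 pby _; exact: cone_r.
Qed.

(* The symmetry of the polygon 0, ..., m.+1 that fixes the new vertex m.+1. *)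
Definition rflip m i : nat := if (i <= m)%N then (m - i)%N else i.

Lemma rflipK m : involutive (rflip m).
Proof.
move=> i; rewrite /rflip; have [im|mi] := leqP i m;
  first by rewrite leq_subr subKn.
by rewrite leqNgt mi.
Qed.

Lemma rflip_le m i : (i <= m)%N -> rflip m i = (m - i)%N.
Proof. by rewrite /rflip => ->. Qed.

Lemma rflip_last m : rflip m m.+1 = m.+1.
Proof. by rewrite /rflip ltnn. Qed.

Lemma rflip_bound m i : (i <= m.+1)%N -> (rflip m i <= m.+1)%N.
Proof. by rewrite /rflip; have [im _|//] := leqP i m; lia. Qed.

Definition Dflip m D i j : R := D (rflip m i) (rflip m j).

Lemma sum_rflip m D : (forall i j, (i <= m)%N -> (j <= m)%N -> D i j = D j i) ->
  \sum_(0 <= t < m) Dflip m D t t.+1 = \sum_(0 <= t < m) D t t.+1.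
Proof.
move=> sym; rewrite [RHS]big_nat_rev /= add0n;
  apply: eq_big_nat => t /andP[_ tm].
rewrite /Dflip !rflip_le ?(ltnW tm) // sym; try lia.
by congr D; lia.
Qed.

Lemma quad_rev D m i j k l : (forall i j, (i <= m)%N -> (j <= m)%N -> D i j = D
  j i) ->
  (i <= m)%N -> (j <= m)%N -> (k <= m)%N -> (l <= m)%N ->
  quad D i j k l -> quad D l k j i.
Proof.
move=> sym im jm km lm [qi [qj [qk [ql [[e1 e2 e3 e4] [e5 e6]]]]]].
exists ql, qk, qj, qi;
  rewrite !(dist_sym ql qk) (dist_sym qk qj) (dist_sym qj qi).
rewrite (dist_sym qi ql) (dist_sym ql qj) (dist_sym qk qi).
rewrite (sym l k) // (sym k j) // (sym j i) // (sym i l) // (sym l j) // (sym k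
  i) //.
Qed.

Lemma quad_rot D i j k l : quad D i j k l -> (D k i = D i k) -> quad D j k l i.
Proof.
move=> [qi [qj [qk [ql [[e1 e2 e3 e4] [e5 e6]]]]]] E.
by exists qj, qk, ql, qi; rewrite E (dist_sym qk qi).
Qed.

(** The flip turns a reflex angle at m into one at 0, so that only the latter has to be treated. *)
Lemma cyc_flip m D : cyc m.+1 D -> cyc m.+1 (Dflip m D).
Proof.
move=> cD; split.
- by move=> i im; apply: (cyc_self cD); exact: rflip_bound.
- by move=> i j im jm; apply: (cyc_sym cD); exact: rflip_bound.
- by move=> i j k im jm km; apply: (cyc_tri cD); exact: rflip_bound.
- move=> /(cyc_per cD); rewrite /per !big_nat_recr //= sum_rflip; last first.
    by move=> i j im jm; apply: (cyc_sym cD); lia.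
  rewrite /Dflip !rflip_last !rflip_le // subnn subn0.
  by rewrite -!addrA (addrC (D 0%N _)) (cyc_sym cD (_ : m <= _)%N) // (cyc_sym
    cD (_ : 0 <= _)%N).
move=> i j k l ij jk kl lm; have symD := cyc_sym cD.
have symF : forall i j, (i <= m.+1)%N -> (j <= m.+1)%N -> Dflip m D i j = Dflip
  m D j i.
  by move=> i' j' im jm; apply: symD; exact: rflip_bound.
have bd i' : (i' <= m.+1)%N -> (rflip m i' <= m.+1)%N by exact: rflip_bound.
have [E|lN] := eqVneq l m.+1.
  suff : quad D (rflip m i) (rflip m j) (rflip m k) (rflip m l) by [].
  have [a [b [c ]]] : exists a b c, [/\ a = rflip m k, b = rflip m j & c =
    rflip m i] by do 3 eexists.
  move=> [ka kb kc]; rewrite -ka -kb -kc E rflip_last.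
  rewrite rflip_le in ka; last by lia.
  rewrite rflip_le in kb; last by lia.
  rewrite rflip_le in kc; last by lia.
  (* Reversing the quadruple puts the fixed vertex m.+1 first; one rotation moves it back to the
     end. *)
  apply: quad_rot; last by apply: symD; lia.
  apply: (quad_rev symD); try lia.
  by apply: (cyc_quad cD); lia.
suff : quad D (rflip m i) (rflip m j) (rflip m k) (rflip m l) by [].
rewrite !rflip_le; try lia.
by apply: (quad_rev symD); try lia; apply: (cyc_quad cD); lia.
Qed.

Lemma cross_rev (a b c d : pt) : cross a c b d -> cross d b c a.
Proof. by move=> H; apply/cross_flip/cross_sym/cross_flip. Qed.

Lemma realizes_flip m D h : cyc m.+1 D -> (0 < m)%N -> realizes m D h ->
  realizes m (Dflip m D) (h \o rflip m).
Proof.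
move=> cD m0 rh; split=> /=.
- move=> i im; rewrite /Dflip !rflip_le //; last exact: ltnW.
  have -> : (m - i = (m - i.+1).+1)%N by lia.
  rewrite dist_sym (real_side rh); last by lia.
  by apply: (cyc_sym cD); lia.
- by rewrite /Dflip !rflip_le // subnn subn0 dist_sym (real_last rh) (cyc_sym
    cD).
- by move=> i j im jm; rewrite /Dflip !rflip_le //; apply: (real_ge rh); lia.
move=> i j k l ij jk kl lm; rewrite !rflip_le; try lia.
by apply: cross_rev; apply: (real_cross rh); lia.
Qed.

Lemma realizes_flipS m D h : cyc m.+1 D -> (0 < m)%N ->
  realizes m.+1 (Dflip m D) h -> realizes m.+1 D (h \o rflip m).
Proof.
move=> cD m0 rh.
have F i j : D i j = Dflip m D (rflip m i) (rflip m j) by rewrite /Dflip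
  !rflipK.
have cF := cyc_flip cD.
split=> /=.
- move=> i im; rewrite F; have [->|im'] := eqVneq i m.
    rewrite rflip_last rflip_le // subnn dist_sym (cyc_sym cF) //.
    exact: (real_last rh).
  rewrite !rflip_le //; try lia.
  have -> : (m - i = (m - i.+1).+1)%N by lia.
  rewrite dist_sym (real_side rh); last by lia.
  by apply: (cyc_sym cF); lia.
- by rewrite F rflip_last rflip_le // subn0 dist_sym (cyc_sym cF) // (real_side
    rh).
- by move=> i j im jm; rewrite F; apply: (real_ge rh); exact: rflip_bound.
move=> i j k l ij jk kl lm; have [E|lN] := eqVneq l m.+1; last first.
  by rewrite !rflip_le; try lia; apply: cross_rev; apply: (real_cross rh); lia.
rewrite E rflip_last !rflip_le; try lia.
by apply: cross_flip; apply: (real_cross rh); lia.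
Qed.

End Polygons.

(** * The induction *)

Section Induction.
Variables (R : realType) (g : geom).
Local Notation pt := (pt R g).
Local Notation lt2pi := (lt2pi g).
Implicit Types (D : nat -> nat -> R) (h : nat -> pt) (i j k l m : nat).

Lemma step_reflex m D h (b : pt) : (1 < m)%N ->
  (forall F, cyc g m F -> exists h', @realizes R g m F h') ->
  cyc g m.+1 D -> realizes m D h ->
  dist b (h 0%N) = D m.+1 0%N -> dist b (h m) = D m m.+1 ->
  (forall j, (0 < j)%N -> (j < m)%N ->
    exists b', farthest (h 0%N) (h m) (h j) (D m.+1 0%N) (D m m.+1) b') ->
  reflex (h 0%N) (h m) b (h 1%N) ->
  exists h', @realizes R g m.+1 D h'.
Proof.
move=> m1 IH cD rh b0 bm far [b' [b'0 b'm b'1]].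
have m0 : (0 < m)%N by lia.
have [beta [K maxK]] : exists beta : nat -> pt,
    (forall j, dist (beta j) (h 0%N) <= D m.+1 0%N /\
               dist (beta j) (h m) <= D m m.+1) /\
    (forall j, (j <= m)%N -> D m.+1 j <= dist (beta j) (h j) /\
      forall q, dist q (h 0%N) <= D m.+1 0%N -> dist q (h m) <= D m m.+1 ->
      dist q (h j) <= dist (beta j) (h j)).
  have ex j : exists q, (0 < j)%N && (j < m)%N ->
      farthest (h 0%N) (h m) (h j) (D m.+1 0%N) (D m m.+1) q.
    case E : ((0 < j)%N && (j < m)%N); last by exists b.
    by move/andP: E => [j0 jm]; have [q hq] := far _ j0 jm; exists q.
  have [be hbe] := choice ex.
  (* At 0 and m the apex b is itself a maximiser, because its distances there equal the prescribed
     bounds. *)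
  exists (fun j => if (0 < j)%N && (j < m)%N then be j else b); split=> j.
    by case: ifP => [/hbe []//|_]; rewrite b0 bm.
  move=> jm; case: ifP => [/[dup] /andP[j0 jm'] /hbe [_ _ hj]|jE].
    by split; [apply: (quad_apex cD rh j0 jm')|move=> q q0 qm;
      apply: (hj (h 0%N) q (h m))].
  have [->|jN] := eqVneq j 0%N; first by rewrite b0.
  have -> : j = m by lia.
  by rewrite bm (cyc_sym cD).
pose ee j := dist (beta j) (h j).
have ee0 : ee 0%N = D m.+1 0%N.
  by apply/eqP; rewrite eq_le (K 0%N).1 (maxK 0%N _).1.
have eem : ee m = D m m.+1.
  by apply/eqP; rewrite eq_le (K m).2 (cyc_sym cD) // (maxK m _).1.
pose N := m.+1.
pose E i j := if i == N then (if j == N then 0 else ee j)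
  else if j == N then ee i else dist (h i) (h j).
have E_in i j : (i <= m)%N -> (j <= m)%N -> E i j = dist (h i) (h j).
  by move=> im jm; rewrite /E !ifN //; lia.
have E_l j : (j <= m)%N -> E N j = ee j by move=> jm; rewrite /E eqxx ifN //;
  lia.
have E_r j : (j <= m)%N -> E j N = ee j by move=> jm; rewrite /E eqxx ifN //;
  lia.
have E_ll : E N N = 0 by rewrite /E !eqxx.
have split_N i : (i <= N)%N -> i = N \/ (i <= m)%N by rewrite /N; lia.
have Esym i j : (i <= N)%N -> (j <= N)%N -> E i j = E j i.
  move=> /split_N[->|im] /split_N[->|jm]; rewrite ?E_ll ?E_l ?E_r ?E_in //.
  exact: dist_sym.
have ee_ge i j : (j <= m)%N -> dist (beta i) (h j) <= ee j.
  by move=> jm; apply: (maxK j jm).2; have [] := K i.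
have Etri i j k : (i <= N)%N -> (j <= N)%N -> (k <= N)%N -> E i k <= E i j + E
  j k.
  move=> /split_N[->|im] /split_N[->|jm] /split_N[->|km];
    rewrite ?E_ll ?E_l ?E_r ?E_in ?addr0 ?add0r //.
  - by rewrite addr_ge0 // dist_ge0.
  - by apply: (le_trans (dist_triangle (h j) _ _)); rewrite lerD2r ee_ge.
  - apply: (le_trans (dist_triangle (beta i) _ _)); rewrite dist_sym.
    by rewrite lerD2l ee_ge.
  - apply: (le_trans (dist_triangle (h j) _ _)); rewrite addrC (dist_sym (h j)).
    by rewrite lerD2l ee_ge.
  exact: dist_triangle.
have leE i j : (i <= N)%N -> (j <= N)%N -> D i j <= E i j.
  move=> /[dup] iN /split_N[->|im] /[dup] jN /split_N[->|jm];
    rewrite ?E_ll ?E_l ?E_r ?E_in //.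
  - by rewrite (cyc_self cD).
  - exact: (maxK j jm).1.
  - by rewrite (cyc_sym cD) //; exact: (maxK i im).1.
  by apply: (real_ge rh).
have Equad i j k l : (i < j)%N -> (j < k)%N -> (k < l)%N -> (l <= N)%N -> quad
  g E i j k l.
  move=> ij jk kl /split_N[lN|lm]; last first.
    by exists (h i), (h j), (h k), (h l); rewrite !E_in //; lia.
  rewrite lN in kl *; have km : (k <= m)%N by [].
  (* Only the diagonal from j to N must be attained, hence the maximiser for j; its distances to h i
     and h k are bounded by the maxima. *)
  exists (h i), (h j), (h k), (beta j).
  rewrite (E_in i j) ?(E_in j k) ?(E_in i k) ?(E_r k) ?(E_l i) ?(E_r j);
    try lia.
  split; first by split=> //; [rewrite dist_sym; apply: ee_ge;
    lia|apply: ee_ge; lia].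
  by rewrite (dist_sym (h j)).
have D01 : D 0%N 1%N = dist (h 0%N) (h 1%N) by rewrite (real_side rh).
(* The straightened apex b' is admissible and attains the triangle inequality through h 0. *)
have ee1 : ee 1%N = D m.+1 0%N + D 0%N 1%N.
  apply/eqP; rewrite eq_le; apply/andP; split.
    apply: (le_trans (dist_triangle (h 0%N) _ _)); rewrite D01 lerD2r.
    exact: (K 1%N).1.
  rewrite -b0 D01 -b'1; apply: (maxK 1%N _).2; first by lia.
    by rewrite b'0 b0.
  by rewrite -bm.
have E_side i : (i <= m)%N -> E i i.+1 = D i i.+1.
  move=> im; have [->|im'] := eqVneq i m; first by rewrite E_r.
  by rewrite E_in ?(real_side rh) //; lia.
(* Vertex 0 is dropped: its two sides are merged into the side from N to 1, so the perimeter is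
   unchanged. *)
pose F i j := E i.+1 j.+1.
have cF : cyc g m F.
  split.
  - move=> i im; rewrite /F; have [->|iN] := split_N i.+1 im; first exact: E_ll.
    by rewrite E_in // distxx.
  - by move=> i j im jm; apply: Esym.
  - by move=> i j k im jm km; apply: Etri.
  - move=> /(cyc_per cD); apply: le_lt_trans; rewrite /per /F big_nat_recl //.
    rewrite (_ : \sum_(0 <= t < m) E t.+1 t.+2 = \sum_(0 <= t < m) D t.+1
      t.+2); last first.
      by apply: eq_big_nat => t tm; apply: E_side; lia.
    by rewrite -/N E_l // ee1; lra.
  by move=> i j k l ij jk kl lm; apply: Equad.
have [f rf] := IH _ cF.
have f_sm := realizes_small rf (cyc_per cF).
have fm0 : dist (f m) (f 0%N) = D m.+1 0%N + D 0%N 1%N.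
  by rewrite (real_last rf) /F -/N E_l.
have nn01 : 0 <= D 0%N 1%N by apply: (cyc_ge0 cD).
have nnN0 : 0 <= D m.+1 0%N by apply: (cyc_ge0 cD).
have [||p [pc pm p0]] := @segment_pt R g (f m) (f 0%N) (D m.+1 0%N).
- by apply: f_sm.
- by rewrite fm0 nnN0 lerDl.
have {}p0 : dist p (f 0%N) = D 0%N 1%N by rewrite p0 fm0; lra.
have p_ge j : (0 < j)%N -> (j <= N)%N -> D 0%N j <= dist p (f j.-1).
  case: j => // j _ jN /=.
  have [->|j0] := eqVneq j 0%N; first by rewrite p0.
  have [->|jm] := eqVneq j m; first by rewrite dist_sym pm (cyc_sym cD).
  have jm' : (j.+1 <= m)%N by lia.
  apply: (@le_trans _ _ (dist (h 0%N) (h j.+1))); first by apply: (real_ge rh).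
  (* [f m, f 0] has the length of the pair beta 1, h 1. With p on it in the role of h 0, the
     crossing is the trivial one at p. *)
  apply: (@crossing _ _ p (f m) (f 0%N) p (f j) (beta 1%N) (h 1%N)) => //.
  - exact: cone_l.
  - by rewrite fm0 -ee1.
  - by rewrite dist_sym (dist_sym p) pm; exact: (K 1%N).1.
  - by rewrite p0 D01.
  - rewrite dist_sym (dist_sym (f j)); apply: (@le_trans _ _ (F m j)).
      by rewrite /F -/N E_l // ee_ge.
    by apply: (real_ge rf) => //; lia.
  apply: (@le_trans _ _ (F j 0%N)); first by rewrite /F E_in.
  by apply: (real_ge rf) => //; lia.
exists (fun i => if i is i'.+1 then f i' else p); split.
- case=> [|i] im; first by rewrite p0.
  by rewrite (real_side rf) // /F E_side.
- exact: pm.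
- case=> [|i] [|j] iN jN.
  + by rewrite (cyc_self cD) // distxx.
  + exact: (p_ge j.+1).
  + by rewrite (cyc_sym cD) // dist_sym; exact: (p_ge i.+1).
  by apply: (le_trans (leE _ _ iN jN)); apply: (real_ge rf).
move=> [|i] [|j] [|k] [|l] // ij jk kl lm; last by apply: (real_cross rf).
(* As p lies on [f m, f 0], its diagonals inherit their crossings from those of f m and f 0. *)
apply: pasch pc _ _; first by apply: f_sm; lia.
  have [->|lm'] := eqVneq l m; first by exists (f m); split;
    [exact: cone_l|exact: cone_r].
  have jk' : (j < k)%N by [].
  have kl' : (k < l)%N by [].
  have lm1 : (l < m)%N by lia.
  exact/cross_flip/cross_sym/(real_cross rf jk' kl' lm1 (leqnn m)).
have [->|j0] := eqVneq j 0%N; first by exists (f 0%N); split; exact: cone_l.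
by apply: (real_cross rf) => //; lia.
Qed.

Lemma pt_at_dist (a : pt) (r : R) : rng g r -> exists b, dist b a = r.
Proof.
move=> hr; have [f [fi [fI fa]]] := to_pole a.
have [||b [Xb Yb Zb]] := @mk_pt R g (sn g r) 0 (cs g r).
- by rewrite cs2 expr0n addr0.
- exact: cs_gt0.
exists (fi b); rewrite -(isom_dist _ _ fI) fa (isomVK fI) dist_sym.
by apply: dist_eq => //; apply: md_pole => //; rewrite Xb Yb expr0n addr0.
Qed.

(** The crossing of [h 0, h j] with [h i, h m] makes the determinants of h i and h j proportional
    with nonnegative coefficients. *)
Lemma chain_side m D h : realizes m D h -> h 0%N <> h m -> exists k : R, k ^+ 2
  = 1 /\
  forall j, (0 < j)%N -> (j < m)%N -> 0 <= k * det (h 0%N) (h m) (h j).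
Proof.
move=> rh hN; pose d j := det (h 0%N) (h m) (h j).
have dd i j : (0 < i)%N -> (i < j)%N -> (j < m)%N -> 0 <= d i * d j.
  move=> i0 ij jm; have [p [[s [t [s0 t0 h1]]] [s' [t' [s'0 t'0 h2]]]]] :=
    real_cross rh i0 ij jm (leqnn m).
  have E : t * d j = s' * d i.
    have := det_combr (h 0%N) (h m) h1;
      rewrite (det_combr (h 0%N) (h m) h2) -/(d i) -/(d j).
    have -> : det (h 0%N) (h m) (h m) = 0 by rewrite /det; ring.
    have -> : det (h 0%N) (h m) (h 0%N) = 0 by rewrite /det; ring.
    by rewrite !mulr0 addr0 add0r => ->.
  (* If both coefficients vanish, the crossing point is h 0 and h m at once. *)
  have [t00|t00] := eqVneq t 0.
    have [s00|s00] := eqVneq s' 0.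
      case: hN; apply/esym; have t'1 : t' != 0 by have := comb_neq0 h2;
        rewrite s00 eqxx /= => ->.
      rewrite t00 in h1; rewrite s00 in h2.
      have h3 : comb p t' (h m) 0 (h 0%N) by case: h2 => ? ? ?; split; lra.
      have h4 : comb p s (h 0%N) 0 (h m) by case: h1 => ? ? ?; split; lra.
      have sE : s = t'.
        have := comb_norm h3; have := comb_norm h4;
          rewrite !(mulr0, mul0r) !expr0n /= !addr0 => s1 t1.
        have /eqP : s ^+ 2 = t' ^+ 2 by rewrite s1 t1.
        rewrite eqf_sqr => /orP[/eqP //|/eqP E1];
          have : 0 < t' by rewrite lt_neqAle eq_sym t'1.
        lra.
      by case: h3 => e1 e2 e3; case: h4 => e4 e5 e6; apply: pt_ext;
        apply: (mulfI t'1); rewrite -[in RHS]sE; lra.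
    have : d i = 0 by apply: (mulfI s00); rewrite -E t00 mul0r mulr0.
    by move=> ->; rewrite mul0r.
  have tp : 0 < t by rewrite lt_neqAle eq_sym t00.
  rewrite -(pmulr_rge0 _ tp) mulrCA E mulrCA mulr_ge0 //.
  by rewrite -expr2 sqr_ge0.
have {}dd i j : (0 < i)%N -> (i < m)%N -> (0 < j)%N -> (j < m)%N -> 0 <= d i *
  d j.
  move=> i0 im j0 jm; case: (ltngtP i j) => [ij|ji|->].
  - exact: dd.
  - by rewrite mulrC; exact: dd.
  by rewrite -expr2 sqr_ge0.
have [[i [i0 [im di]]]|H] := pselect (exists i, (0 < i)%N /\ (i < m)%N /\ d i <
  0).
  exists (-1); split; first by rewrite sqrrN expr1n.
  move=> j j0 jm; rewrite mulN1r oppr_ge0 -/(d j) leNgt; apply/negP => dj.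
  by have := dd _ _ i0 im j0 jm; rewrite leNgt nmulr_rlt0 // dj.
exists 1; split; first by rewrite expr1n.
move=> j j0 jm; rewrite mul1r -/(d j) leNgt; apply/negP => dj; apply: H.
by exists j.
Qed.

Lemma perimeter_rng m D i j : cyc g m D -> (i <= m)%N -> (j <= m)%N -> rng g (D
  i j).
Proof.
move=> cD; wlog ij : i j / (i <= j)%N.
  move=> H im jm; have [ij|ji] := leqP i j; first exact: H.
  by rewrite (cyc_sym cD) //; apply: H => //; lia.
move=> im jm; split; first exact: (cyc_ge0 cD).
move=> gS; have := cyc_per cD gS;
  rewrite /per mulr2n (@big_split3 _ _ i j m) //.
have h1 := polygon_path_le (cyc_self cD) (cyc_tri cD) ij jm.
have h2 := polygon_path_le (cyc_self cD) (cyc_tri cD) (leq0n i) im.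
have h3 := polygon_path_le (cyc_self cD) (cyc_tri cD) jm (leqnn m).
have := cyc_tri cD im (leq0n m) jm; have := cyc_tri cD (leq0n m) (leqnn m) jm.
rewrite (cyc_sym cD im (leq0n m)) (cyc_sym cD (leqnn m) jm) (cyc_sym cD (leq0n
  m) (leqnn m)).
by move=> h4 h5; clear gS; lra.
Qed.

Theorem cyc_realizes m D : (0 < m)%N -> cyc g m D -> exists h, @realizes R g m
  D h.
Proof.
elim: m D => // m IH D _ cD.
(* The induction starts with a digon, whose perimeter counts its side twice; triangles already arise
   from the general step. *)
have [m00|m0] := eqVneq m 0%N.
  rewrite m00 in cD *.
  have [b ba] := pt_at_dist (pole R g) (perimeter_rng cD (leq0n 1) (leqnn 1)).
  exists (fun i => if i == 0%N then pole R g else b); split=> //=.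
  - by case=> // _; rewrite dist_sym.
  - by rewrite ba (cyc_sym cD).
  - case=> [|[|i]] // [|[|j]] // _ _ /=; rewrite ?distxx ?(cyc_self cD) //.
      by rewrite dist_sym ba.
    by rewrite ba (cyc_sym cD).
  by move=> i j k l ij jk kl l1; exfalso; lia.
have {}m0 : (0 < m)%N by lia.
have cD' := cyc_restrict cD m0.
have [h rh] := IH D m0 cD'.
have {}IH F : cyc g m F -> exists h', @realizes R g m F h' by exact: IH.
have h_sm := realizes_small rh (cyc_per cD').
set l1 := D m.+1 0%N; set l2 := D m m.+1.
have l10 : 0 <= l1 by apply: (cyc_ge0 cD).
have l20 : 0 <= l2 by apply: (cyc_ge0 cD).
have rl1 : rng g l1 by apply: (perimeter_rng cD).
have hm0 : dist (h 0%N) (h m) = D m 0%N by rewrite dist_sym (real_last rh).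
have perE : per m.+1 D = \sum_(0 <= t < m) D t t.+1 + l2 + l1 by rewrite /per
  big_nat_recr.
have perj j : (j <= m)%N ->
    lt2pi (l1 + dist (h 0%N) (h j) + dist (h j) (h m) + l2).
  move=> jm /(cyc_per cD); rewrite perE; apply: le_lt_trans.
  rewrite (@big_split3 _ _ 0 j m) // big_geq // add0r.
  have := realizes_path rh (leq0n j) jm; have := realizes_path rh jm (leqnn m).
  lra.
have perm : lt2pi (l1 + l2 + dist (h 0%N) (h m)).
  by move=> /(perj m (leqnn m)); rewrite distxx; lra.
have step_refl (b : pt) : dist b (h 0%N) = l1 -> dist b (h m) = l2 -> (1 < m)%N
  ->
    (forall j, (0 < j)%N -> (j < m)%N ->
      exists b', farthest (h 0%N) (h m) (h j) l1 l2 b') ->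
    reflex (h 0%N) (h m) b (h 1%N) \/ reflex (h m) (h 0%N) b (h m.-1) ->
    exists h', @realizes R g m.+1 D h'.
  move=> b0 bm m1 far [refl|refl];
    first exact: (step_reflex m1 IH cD rh b0 bm far refl).
  have [h' rh'] : exists h', @realizes R g m.+1 (Dflip m D) h'.
    apply: (step_reflex (b := b) m1 IH (cyc_flip cD) (realizes_flip cD m0 rh)).
    - by rewrite /= rflip_le // subn0 bm /Dflip rflip_last rflip_le // subn0
        (cyc_sym cD).
    - by rewrite /= rflip_le // subnn b0 /Dflip rflip_last rflip_le // subnn
        (cyc_sym cD).
    - move=> j j0 jm; rewrite /Dflip /= rflip_last !rflip_le //;
        last exact: ltnW.
      rewrite subnn subn0 (cyc_sym cD _ (leqnn m.+1)) // (cyc_sym cD (leqnn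
        m.+1)) //.
      have [||b' hb'] := far (m - j)%N; try lia.
      exists b'; apply: farthest_sym; move: hb'.
      by rewrite /l1 /l2 (cyc_sym cD (leqnn _)) // (cyc_sym cD _ (leqnn _)).
    by rewrite /= !rflip_le // subnn subn0 subn1.
  by exists (h' \o rflip m); exact: realizes_flipS.
have [E|hN] := pselect (h 0%N = h m).
  have D0 : D m 0%N = 0 by rewrite -hm0 E distxx.
  have l12 : l1 = l2.
    have := cyc_tri cD (leqnn m.+1) (leqnSn m) (leq0n m.+1).
    have := cyc_tri cD (leqnSn m) (leq0n m.+1) (leqnn m.+1).
    rewrite D0 -/l1 (cyc_sym cD (leqnn m.+1) (leqnSn m)) (cyc_sym cD (leq0n
      m.+1) (leqnn m.+1)) -/l2 -/l1.
    lra.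
  have [b ba] := pt_at_dist (h 0%N) rl1.
  have bm : dist b (h m) = l2 by rewrite -E ba.
  have [m1|m1] := leqP m 1.
    exists (extend m.+1 h b); apply: realizes_extend => // j j0 jm; lia.
  (* The base is a point, and the triangle glued to it is a doubled segment in an arbitrary
     direction. *)
  have refl j : (0 < j)%N -> (j < m)%N -> reflex (h 0%N) (h m) b (h j).
    move=> j0 jm; rewrite -E; apply: reflex_eq; have := perj j (ltnW jm).
    by rewrite -E ba l12.
  apply: (step_refl b) => //; last by left; apply: refl.
  by move=> j j0 jm; have := reflex_farthest (refl _ j0 jm); rewrite ba bm.
have D0 : 0 < dist (h 0%N) (h m) by exact: dist_gt0.
have smD : small g (dist (h 0%N) (h m)) by apply: h_sm.
have [k [k1 kh]] := chain_side rh hN.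
(* The triangle is erected on the side of the base away from the polygon. *)
have [|||b [ba bm bk]] := apex k D0 smD l10 l20 _ _ _ perm.
- rewrite hm0 addrC (cyc_sym cD' (leqnn m)) //.
  have := cyc_tri cD (leq0n m.+1) (leqnSn m) (leqnn m.+1);
    rewrite (cyc_sym cD (leq0n _) (leqnn _)).
  by [].
- by rewrite hm0 addrC /l2 /l1 (cyc_sym cD (leqnn m.+1)) //;
    apply: (cyc_tri cD).
- by rewrite hm0 addrC; apply: (cyc_tri cD).
have smb j : (j <= m)%N -> small g (dist b (h j)).
  move=> jm gS; have := perj j jm gS; rewrite mulr2n.
  have := dist_triangle (h 0%N) b (h j); have := dist_triangle (h m) b (h j).
  by rewrite ba bm (dist_sym (h m)) => ? ? ?; clear gS; lra.
have far j : (0 < j)%N -> (j < m)%N ->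
    exists b', farthest (h 0%N) (h m) (h j) l1 l2 b'.
  move=> j0 jm; rewrite -ba -bm; apply: (farthest_exists k1) => //.
  - exact/smb/ltnW.
  - by rewrite ba bm; apply: perj; exact: ltnW.
  exact: kh.
have [m1|m1] := leqP m 1.
  exists (extend m.+1 h b); apply: realizes_extend => // j j0 jm; lia.
have [refl|nr1] := pselect (reflex (h 0%N) (h m) b (h 1%N)).
  by apply: (step_refl b) => //; left.
have [refl|nr2] := pselect (reflex (h m) (h 0%N) b (h m.-1)).
  by apply: (step_refl b) => //; right.
exists (extend m.+1 h b); apply: realizes_extend => // j j0 jm.
apply: (convex_apex_cross k1 D0 smD _ _ _ _ _ _ bk nr1 nr2) => //.
- exact/smb/ltnW.
- by rewrite ba bm; apply: perj; lia.
- by rewrite ba bm; apply: perj; lia.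
- by apply: kh; lia.
- by apply: kh; lia.
- exact: kh.
- have [->|j1] := eqVneq j 1%N; last by apply: (real_cross rh) => //; lia.
  by exists (h 1%N); split; [exact: cone_r|exact: cone_l].
have [->|j1] := eqVneq j m.-1; last by apply: (real_cross rh) => //; lia.
by exists (h m.-1); split; [exact: cone_r|exact: cone_l].
Qed.

End Induction.

(** * Transfer to the model plane *)

Section Model.
Variables (R : realType) (k : R).

(** The function [z] absorbs the one mismatch of coordinates: the plane has height 0 in [model] and
    height 1 in [pt]. *)
Lemma model_bij (g : geom) (s : R) (z : pt R g -> R) :
  (forall u, model_point k (X u, Y u, z u)) ->
  (forall p : model k, exists u, \val p = (X u, Y u, z u)) ->
  (forall u v, z u = z v -> Z u = Z v) ->
  (forall u v (p q : model k), \val p = (X u, Y u, z u) ->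
    \val q = (X v, Y v, z v) -> model_dist p q = dist u v / s) ->
  exists (T : pt R g -> model k) (Ti : model k -> pt R g),
    [/\ cancel T Ti, cancel Ti T &
        forall u v, model_dist (T u) (T v) = dist u v / s].
Proof.
move=> hz /choice[Ti hTi] zZ hd.
pose T u : model k := exist (fun p => model_point k p) _ (hz u).
exists T, Ti; split.
- by move=> u; have [hX hY /zZ hZ] := hTi (T u); apply: pt_ext.
- by move=> p; apply: val_inj; rewrite [RHS]hTi.
by move=> u v; apply: hd.
Qed.

Lemma model_geom : exists (g : geom) (s : R) (T : pt R g -> model k)
    (Ti : model k -> pt R g),
  [/\ 0 < s, cancel T Ti, cancel Ti T,
      forall u v, model_dist (T u) (T v) = dist u v / s &
      (g = Sph /\ model_diam k = (pi / s)%:E) \/ (g <> Sph /\ model_diam k =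
        +oo%E)].
Proof.
have [k0|k0] := boolP (0 < k).
  have [||//||T [Ti [h1 h2 h3]]] := @model_bij Sph (Num.sqrt k) (@Z R Sph).
  - by move=> u; rewrite /model_point k0 Z2 /=; apply/eqP; ring.
  - case=> [[[x y] z] h].
    have E : x ^+ 2 + y ^+ 2 + z ^+ 2 = 1.
      by apply/eqP; have := h; rewrite /model_point k0.
    have [||u [Xu Yu Zu]] := @mk_pt R Sph x y z; rewrite //=; first by lra.
    by exists u; rewrite /= Xu Yu Zu.
  - move=> u v p q hp hq; rewrite /model_dist hp hq k0 distE /=;
      congr (acos _ / _).
    have := md_curv u v; rewrite /pr /=; lra.
  exists Sph, (Num.sqrt k), T, Ti; split=> //; first by rewrite sqrtr_gt0.
  by left; rewrite /model_diam k0.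
have [k1|k1] := boolP (k < 0).
  have [||//||T [Ti [h1 h2 h3]]] := @model_bij Hyp (Num.sqrt (- k)) (@Z R Hyp).
  - move=> u; rewrite /model_point (negPf k0) k1 Z2 /= Z_gt0 // andbT.
    by apply/eqP; ring.
  - case=> [[[x y] z] h].
    have /andP[/eqP E z0] : (z ^+ 2 - x ^+ 2 - y ^+ 2 == 1) && (0 < z).
      by have := h; rewrite /model_point (negPf k0) k1.
    have [||u [Xu Yu Zu]] := @mk_pt R Hyp x y z; rewrite //=; first by lra.
    by exists u; rewrite /= Xu Yu Zu.
  - move=> u v p q hp hq; rewrite /model_dist hp hq (negPf k0) k1 distE /=.
    congr (arcosh _ / _); have := md_curv u v; rewrite /pr /=; lra.
  exists Hyp, (Num.sqrt (- k)), T, Ti; split=> //; first by rewrite sqrtr_gt0;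
    lra.
  by right; rewrite /model_diam (negPf k0).
have [||||T [Ti [h1 h2 h3]]] := @model_bij Euc 1 (fun _ => 0).
- by move=> u; rewrite /model_point (negPf k0) (negPf k1).
- case=> [[[x y] z] h].
  have E : z = 0 by apply/eqP; have := h;
    rewrite /model_point (negPf k0) (negPf k1).
  have [||u [Xu Yu Zu]] := @mk_pt R Euc x y 1; rewrite //=.
    by rewrite mul0r subr0 expr1n.
  by exists u; rewrite /= Xu Yu E.
- by move=> u v _; rewrite !Z_Euc.
- move=> u v p q hp hq;
    rewrite /model_dist hp hq (negPf k0) (negPf k1) distE /=.
  by rewrite mdE divr1; congr Num.sqrt; rewrite /=; field.
exists Euc, 1, T, Ti; split=> //.
by right; rewrite /model_diam (negPf k0).
Qed.

End Model.

Lemma cone_model_segment (R : realType) (k : R) (g : geom) (s : R)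
    (T : pt R g -> model k) (a c p : pt R g) : 0 < s ->
  (forall u v, model_dist (T u) (T v) = dist u v / s) ->
  small g (dist a c) -> cone p a c -> model_segment (T a) (T c) (T p).
Proof.
move=> s0 hT sm pac.
have [h [h0 hd hmd _ /(_ sm p pac) [t0 /andP[t00 t0d] ->]]] := line a c.
have [_ dpi] := dist_rng a c.
have sc (r : R) : r / s * s = r by rewrite divfK // lt0r_neq0.
have E u v : 0 <= u <= dist a c -> 0 <= v <= dist a c -> dist (h u) (h v) = `|u
  - v|.
  move=> /andP[u0 ud] /andP[v0 vd]; apply: dist_eq;
    last by rewrite hmd hsq_norm.
  split=> [//|/dpi le]; apply: le_trans le.
  by rewrite ler_norml; apply/andP; split; lra.
have rs (r : R) : 0 <= r <= model_dist (T a) (T c) -> 0 <= r * s <= dist a c.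
  rewrite hT => /andP[r0 rd]; apply/andP; split;
    first by rewrite mulr_ge0 // ltW.
  by rewrite -ler_pdivlMr.
exists (fun t => T (h (t * s))); split; first split.
- by rewrite mul0r h0.
- by rewrite hT sc hd.
- move=> u v hu hv; rewrite hT E; [|exact: rs|exact: rs].
  by rewrite -mulrBl normrM (gtr0_norm s0) mulfK // lt0r_neq0.
exists (t0 / s); last by rewrite sc.
rewrite hT; apply/andP; split; first by rewrite divr_ge0 // ltW.
by rewrite ler_pM2r // invr_gt0.
Qed.

(** If j is a neighbour of i the segments share an endpoint. Otherwise i0, i, i1, j are in cyclic
    order, and the cases only locate where the indices wrap around. *)
Lemma realizes_diagonals (R : realType) (g : geom) m D h (i j i0 i1 : nat) :
  @realizes R g m D h -> (1 < m)%N -> (i <= m)%N -> (j <= m)%N -> i <> j ->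
  i1 = (if i == m then 0%N else i.+1) -> i = (if i0 == m then 0%N else i0.+1) ->
  (i0 <= m)%N ->
  exists p, cone p (h i) (h j) /\ cone p (h i0) (h i1).
Proof.
move=> rh m1 im jm ij hi1 hi i0m.
have [->|ji1] := eqVneq j i1; first by exists (h i1); split; exact: cone_r.
have [->|ji0] := eqVneq j i0.
  by exists (h i0); split; [exact: cone_r|exact: cone_l].
have C a b c d : (a < b)%N -> (b < c)%N -> (c < d)%N -> (d <= m)%N ->
  cross (h a) (h c) (h b) (h d) by move=> *; apply: (real_cross rh).
have [iE|iN] := eqVneq i 0%N.
  have i0E : i0 = m by move: hi; case: eqP => ? ?; lia.
  have i1E : i1 = 1%N by move: hi1; case: eqP => ? ?; lia.
  rewrite iE i0E i1E; have [||||p [p1 p2]] := C 0%N 1%N j m; try lia.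
  by exists p; split=> //; exact: cone_sym.
have i0E : i0 = i.-1 by move: hi; case: eqP => ? ?; lia.
have [iE|iN'] := eqVneq i m.
  have i1E : i1 = 0%N by rewrite hi1 iE eqxx.
  rewrite i0E i1E iE; have [||||p [p1 p2]] := C 0%N j m.-1 m; try lia.
  by exists p; split; exact: cone_sym.
have i1E : i1 = i.+1 by rewrite hi1 ifN.
rewrite i0E i1E; have [ji|ij'] := ltnP j i.
  have [||||p [p1 p2]] := C j i.-1 i i.+1; try lia.
  by exists p; split=> //; exact: cone_sym.
have [||||p [p1 p2]] := C i.-1 i i.+1 j; try lia.
by exists p.
Qed.

(** Lets a cyclic quadruple inherit the perimeter bound, as the four-point hypothesis on the space
    demands. *)
Lemma cycle_quad_le (R : realType) (g : geom) m (D : nat -> nat -> R) (i j k l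
  : nat) :
  (forall i, (i <= m)%N -> D i i = 0) ->
  (forall i j k, (i <= m)%N -> (j <= m)%N -> (k <= m)%N -> D i k <= D i j + D j
    k) ->
  (i < j)%N -> (j < k)%N -> (k < l)%N -> (l <= m)%N ->
  D i j + D j k + D k l + D l i <= per m D.
Proof.
move=> self tri ij jk kl lm.
have h1 := polygon_path_le self tri (leq0n i) (_ : i <= m)%N.
have h2 := polygon_path_le self tri (ltnW ij) (_ : j <= m)%N.
have h3 := polygon_path_le self tri (ltnW jk) (_ : k <= m)%N.
have h4 := polygon_path_le self tri (ltnW kl) lm.
have h5 := polygon_path_le self tri lm (leqnn m).
have := tri l m i lm (leqnn m) (_ : i <= m)%N;
  have := tri m 0%N i (leqnn m) (leq0n m) (_ : i <= m)%N.
rewrite /per (@big_split3 _ _ i j m) ?(@big_cat_nat _ _ _ k j m) ?(@big_cat_nat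
  _ _ _ l k m) //=; try lia.
move: h1 h2 h3 => /(_ ltac:(lia)) h1 /(_ ltac:(lia)) h2 /(_ ltac:(lia)) h3.
move=> /(_ ltac:(lia)) h6 /(_ ltac:(lia)) h7; lra.
Qed.

Lemma Zp_succ_val m (i : 'I_m.+2) :
  (i + 1 : 'I_m.+2) = (if i == m.+1 :> nat then 0%N else i.+1) :> nat.
Proof.
rewrite /= (modn_small (_ : 1 < m.+2)%N) // addn1; case: eqP => [->|iN].
  by rewrite modnn.
by rewrite modn_small //; have := ltn_ord i; lia.
Qed.

Lemma lt_perimeter (R : realType) (k : R) (g : geom) (s x : R) : 0 < s ->
  (g = Sph /\ model_diam k = (pi / s)%:E) \/ (g <> Sph /\ model_diam k = +oo%E)
    ->
  (x%:E < 2%:E * model_diam k)%E <-> lt2pi g (s * x).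
Proof.
move=> s0 [[gS ->]|[gS ->]].
  rewrite -EFinM lte_fin mulrA ltr_pdivlMr // (mulrC x) mulr_natl.
  by split=> [h _ //|]; apply.
rewrite mulry gtr0_sg // mul1e; split=> [_ //|_]; exact: ltry.
Qed.

Section Transfer.
Variables (R : realType) (k : R) (X : metricType R).

Lemma Cycl_quad (g : geom) (s : R) (T : pt R g -> model k) (Ti : model k -> pt
  R g)
    (x0 x1 x2 x3 : X) :
  0 < s -> cancel Ti T -> (forall u v, model_dist (T u) (T v) = dist u v / s) ->
  Cycl 4 k X ->
  ((mdist x0 x1 + mdist x1 x2 + mdist x2 x3 + mdist x3 x0)%:E < 2%:E *
    model_diam k)%E ->
  exists q0 q1 q2 q3 : pt R g,
  [/\ dist q0 q1 <= s * mdist x0 x1, dist q1 q2 <= s * mdist x1 x2,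
      dist q2 q3 <= s * mdist x2 x3 & dist q3 q0 <= s * mdist x3 x0] /\
  (s * mdist x0 x2 <= dist q0 q2 /\ s * mdist x1 x3 <= dist q1 q3).
Proof.
move=> s0 TiK hT hX hper.
pose f (i : 'Z_4) : X := nth x0 [:: x0; x1; x2; x3] i.
have [|q [qs qd]] := hX f.
  by rewrite /perimeter !big_ord_recl big_ord0 addr0 !addrA; exact: hper.
have distE' u v : dist (Ti u) (Ti v) = s * model_dist u v.
  by rewrite -{2}(TiK u) -{2}(TiK v) hT mulrC divfK // lt0r_neq0.
(* Iterated sums make the side inequalities at a1 and a2 speak of a2 and a3 by conversion. *)
pose a0 : 'Z_4 := 0; pose a1 : 'Z_4 := 1; pose a2 : 'Z_4 := 1 + 1;
  pose a3 : 'Z_4 := 1 + 1 + 1.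
have a30 : a3 + 1 = a0 by apply: val_inj.
have a01 : a0 + 1 = a1 by apply: val_inj.
exists (Ti (q a0)), (Ti (q a1)), (Ti (q a2)), (Ti (q a3)).
rewrite !distE' !ler_pM2l //.
have := qs a0; rewrite a01 => h0; have h1 := qs a1; have h2 := qs a2.
have := qs a3; rewrite a30 => h3; do !split => //.
- by apply: (qd a0 a2) => /(congr1 val).
- by apply: (qd a1 a3) => /(congr1 val).
Qed.

End Transfer.

Theorem theorem1p5 (R : realType) (k : R) (X : metricType R)
    (hX : Cycl 4 k X) (n : nat) (hn : (3 <= n)%N) (f : 'Z_n -> X)
    (hper : ((perimeter f)%:E < 2%:E * model_diam k)%E)
    (hf : forall j : 'Z_n, f j <> f (j + 1)) :
  exists g : 'Z_n -> model k,
    (forall i j : 'Z_n,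
       model_dist (g i) (g (i + 1)) = mdist (f i) (f (i + 1)) /\
       mdist (f i) (f j) <= model_dist (g i) (g j)) /\
    (forall i j : 'Z_n, i <> j ->
       model_segment (g i) (g j) `&`
         model_segment (g (i - 1)) (g (i + 1)) !=set0).
Proof.
case: n hn f hper {hf} => [|[|[|n]]] // _ f hper.
pose m := n.+2.
have [g [s [T [Ti [s0 TK TiK hT hdiam]]]]] := model_geom k.
pose F (i : nat) : X := f (inord i : 'I_m.+1).
(* The factor [s] rescales to curvature 1, 0 or -1. *)
pose D i j := s * mdist (F i) (F j).
have self i : (i <= m)%N -> D i i = 0 by rewrite /D mdistxx mulr0.
have tri i j l : (i <= m)%N -> (j <= m)%N -> (l <= m)%N -> D i l <= D i j + D j
  l.
  by move=> _ _ _; rewrite /D -mulrDr ler_pM2l // metric_triangle.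
have FE (i : 'Z_n.+3) : F i = f i by rewrite /F inord_val.
have FS (i : 'Z_n.+3) : F (if i == m :> nat then 0%N else i.+1) = f (i + 1).
  by rewrite -(Zp_succ_val (m := n.+1)) FE.
have perE : per m D = s * perimeter f.
  rewrite /perimeter big_ord_recr /= /per mulrDr mulr_sumr big_mkord.
  congr (_ + _).
    apply: eq_bigr => i _; rewrite /D -FE -FS /= ifN //.
    by rewrite neq_ltn ltn_ord.
  by rewrite /D -FE -FS /= eqxx.
have cD : cyc g m D.
  split=> //.
  - by move=> i j _ _; rewrite /D metric_sym.
  - by rewrite perE; apply/(lt_perimeter _ s0 hdiam).
  move=> i j l l' ij jl ll' lm.
  apply: (Cycl_quad s0 TiK hT hX); apply/(lt_perimeter _ s0 hdiam).
  have per0 : lt2pi g (per m D) by rewrite perE;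
    apply/(lt_perimeter _ s0 hdiam).
  move=> /per0; apply: le_lt_trans; rewrite !mulrDr.
  exact: (cycle_quad_le g self tri).
have [h rh] := cyc_realizes (ltn0Sn _) cD.
have sm := realizes_small rh (cyc_per cD).
have dE (u v : pt R g) x : s * x = dist u v -> x = dist u v / s.
  by move=> <-; rewrite mulrC mulKf // lt0r_neq0.
have le_m (i : 'Z_n.+3) : (i <= m)%N by have := ltn_ord i.
exists (fun i => T (h i)); split=> [i j|i j ij].
  rewrite !hT; split.
    apply/esym/dE; rewrite -FE -FS.
    rewrite (Zp_succ_val (m := n.+1)); case: eqP => [iE|iN].
      by rewrite iE (real_last rh).
    by rewrite (real_side rh) //; have := le_m i; lia.
  rewrite ler_pdivlMr // mulrC -!FE.
  exact: (real_ge rh).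
have iN : (i : nat) <> j by move/val_inj.
pose i0 : 'Z_n.+3 := i - 1.
have iE : (i : nat) = (if i0 == m :> nat then 0%N else i0.+1).
  by rewrite -(Zp_succ_val (m := n.+1)) subrK.
have [p [p1 p2]] := realizes_diagonals rh (isT : (1 < m)%N) (le_m i) (le_m j) iN
  (Zp_succ_val (m := n.+1) i) iE (le_m i0).
exists (T p); split.
  exact: (cone_model_segment s0 hT (sm _ _ (le_m _) (le_m _)) p1).
exact: (cone_model_segment s0 hT (sm _ _ (le_m _) (le_m _)) p2).
Qed.
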